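(* Let $p\in(1,\infty)$ and let $\varphi:\mathbb R^{n+1}\times\mathbb R_+\to\mathbb R_+$ be a measurable positive function such that $$\int_{r}^{\infty}\Big(1+\ln\frac sr\Big)\frac{\operatorname*{ess\,inf}_{s<\zeta<\infty}\varphi(x,\zeta)\,\zeta^{\frac{n+2}{p}}}{s^{\frac{n+2}{p}+1}}\,ds\le C\,\varphi(x,r)\quad\forall\,(x,r)\in\mathbb R^{n+1}\times\mathbb R_+,$$ where $C$ is independent of $x$ and $r$. Suppose $a\in BMO$ and let $T_a$ be a sublinear operator such that, for every $f\in L_1(\mathbb R^{n+1})$ with compact support and every $x\notin\operatorname{supp}f$, $$|T_af(x)|\le C\int_{\mathbb R^{n+1}}|a(x)-a(y)|\frac{|f(y)|}{\rho(x-y)^{n+2}}\,dy .$$ If $T_a$ is bounded in $L_p(\mathbb R^{n+1})$, with $\|T_af\|_{p;\mathbb R^{n+1}}\le C\|a\|_*\|f\|_{p;\mathbb R^{n+1}}$ where $C$ is independent of $a$ and $f$, then $T_a$ is bounded in $M_{p,\varphi}(\mathbb R^{n+1})$ and $$\|T_af\|_{p,\varphi;\mathbb R^{n+1}}\le C\|a\|_*\,\|f\|_{p,\varphi;\mathbb R^{n+1}}$$ with a constant independent of $a$ and $f$.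
   Context: Points of $\mathbb R^{n+1}$ are $x=(x',t)$, $y=(y',\tau)$ with $x',y'\in\mathbb R^n$; $\mathbb R_+=(0,\infty)$. The letter $C$ denotes positive constants that may differ from one occurrence to another; the one in the pointwise bound does not depend on $a$, $f$ or $x$. $\rho(x)=\Big(\frac{|x'|^2+\sqrt{|x'|^4+4t^2}}{2}\Big)^{1/2}$ and $\mathcal E_r(x)=\{y\in\mathbb R^{n+1}:\frac{|x'-y'|^2}{r^2}+\frac{|t-\tau|^2}{r^4}<1\}$. $\|f\|_{p;A}$ is the $L_p(A)$ norm. $BMO$: $a\in L_1^{\rm loc}(\mathbb R^{n+1})$ with $\|a\|_*=\sup\frac1{|\mathcal E_r|}\int_{\mathcal E_r}|a(y)-a_{\mathcal E_r}|dy<\infty$, the supremum over all ellipsoids $\mathcal E_r=\mathcal E_r(x)$, $x\in\mathbb R^{n+1}$, $r>0$; $a_{\mathcal E_r}$ is the mean of $a$ over $\mathcal E_r$. $M_{p,\varphi}(\mathbb R^{n+1})$ consists of $f\in L_p^{\rm loc}(\mathbb R^{n+1})$ with $$\|f\|_{p,\varphi;\mathbb R^{n+1}}=\sup_{(x,r)\in\mathbb R^{n+1}\times\mathbb R_+}\varphi(x,r)^{-1}\Big(r^{-(n+2)}\int_{\mathcal E_r(x)}|f(y)|^pdy\Big)^{1/p}<\infty .$$ Sublinear means $|T_a(f+g)|\le|T_af|+|T_ag|$ a.e.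
   Formalization: The bound is proved for f in M_{p,φ} that lie in L_p or for which T_a f is measurable and |T_a f| ≤ limsup_k |T_a(f·1_{E_k(0)})| a.e.; without such a link the values of T_a outside L_p are unconstrained and the claim fails. *)

(* Defs.v *)
From HB Require Import structures.
From mathcomp Require Import all_boot all_order all_algebra.
From mathcomp Require Import all_classical all_reals all_analysis.
From mathcomp Require Import ess_sup_inf.
Set Implicit Arguments.
Unset Strict Implicit.
Unset Printing Implicit Defensive.
Import Order.TTheory GRing.Theory Num.Theory.
Import numFieldNormedType.Exports.
Local Open Scope classical_set_scope.
Local Open Scope ring_scope.

(* The Borel sigma-algebra of R^n, generated by the n coordinate maps. *)
Definition rV_display : measure_display.
Proof. exact: default_measure_display. Qed.

Section rV_measurable.
Context {R : realType} (n : nat).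

Let coord (i : 'I_n) (x : 'rV[R]_n) : R := x ord0 i.

Let rV_set0 : g_sigma_preimage coord set0.
Proof. exact: sigma_algebra0. Qed.

Let rV_setC A : g_sigma_preimage coord A -> g_sigma_preimage coord (~` A).
Proof. exact: sigma_algebraC. Qed.

Let rV_bigcup (F : (set 'rV[R]_n)^nat) :
  (forall i, g_sigma_preimage coord (F i)) ->
  g_sigma_preimage coord (\bigcup_i F i).
Proof. exact: sigma_algebra_bigcup. Qed.

HB.instance Definition _ := @isMeasurable.Build rV_display 'rV[R]_n
  (g_sigma_preimage coord) rV_set0 rV_setC rV_bigcup.

End rV_measurable.

Definition rV_snoc {R : realType} n (xt : 'rV[R]_n * R) : 'rV[R]_n.+1 :=
  \row_(i < n.+1) if unlift ord_max i is Some j then xt.1 ord0 j else xt.2.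

Lemma measurable_rV_coord {R : realType} n (i : 'I_n) :
  measurable_fun [set: 'rV[R]_n] (fun x : 'rV[R]_n => x ord0 i).
Proof.
move=> _ Y mY; rewrite setTI; apply: sub_sigma_algebra => /=.
rewrite -bigcup_seq/=; exists i => /=; first by rewrite mem_index_enum.
by exists Y => //; rewrite setTI.
Qed.

Lemma measurable_rV_snoc {R : realType} n :
  measurable_fun [set: 'rV[R]_n * R] (@rV_snoc R n).
Proof.
move=> _ A mA; rewrite setTI; move: A mA; apply: smallest_sub.
  split => /=.
  - by rewrite preimage_set0.
  - by move=> A mA; rewrite setTD preimage_setC; exact: measurableC.
  - by move=> F mF; rewrite preimage_bigcup; exact: bigcup_measurable.
move=> A; rewrite -bigcup_seq/= => -[i _ [B mB <-]]; rewrite setTI.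
have [j|ei] := unliftP ord_max i.
- move=> ei; have -> : @rV_snoc R n @^-1` ((fun x => x ord0 i) @^-1` B) =
    setT `&` (fun xt : 'rV[R]_n * R => xt.1 ord0 j) @^-1` B.
    by rewrite setTI; apply/funext => xt; rewrite /preimage/= mxE ei liftK.
  apply: (measurableT_comp (measurable_rV_coord j) measurable_fst) => //.
- have -> : @rV_snoc R n @^-1` ((fun x => x ord0 i) @^-1` B) =
    setT `&` (@snd 'rV[R]_n R) @^-1` B.
    by rewrite setTI; apply/funext => xt; rewrite /preimage/= mxE ei unlift_none.
  exact: measurable_snd.
Qed.

(* Lebesgue measure on R^n: the single point of R^0 has mass 1, and the measure
   on R^(n+1) is the image under rV_snoc of the product measure on R^n x R. *)
Fixpoint lebesgue_rV {R : realType} (n : nat) :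
    {measure set 'rV[R]_n -> \bar R} :=
  if n is m.+1 return {measure set 'rV[R]_n -> \bar R} then
    measure_function_pushforward__canonical__measure_function_Measure
      (@lebesgue_rV R m \x @lebesgue_measure R)%E (@measurable_rV_snoc R m)
  else \d_ (0 : 'rV[R]_0).

Lemma lebesgue_rV_box {R : realType} n (A : 'I_n -> set R) :
  (forall i, measurable (A i)) ->
  lebesgue_rV n [set x : 'rV[R]_n | forall i, A i (x ord0 i)] =
  (\prod_(i < n) lebesgue_measure (A i))%E.
Proof.
elim: n A => [|n IH] A mA /=.
  by rewrite big_ord0 diracE (_ : 0 \in _ = true)//; apply/mem_set => -[].
rewrite big_ord_recr/= -IH//.
have mbox : measurable [set x : 'rV[R]_n |
    forall i, A (widen_ord (leqnSn n) i) (x ord0 i)].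
  rewrite [X in measurable X](_ : _ = \big[setI/setT]_(i < n)
      ((fun x : 'rV[R]_n => x ord0 i) @^-1` A (widen_ord (leqnSn n) i))).
    apply: bigsetI_measurable => i _; rewrite -[X in measurable X]setTI.
    exact: measurable_rV_coord.
  rewrite -bigcap_seq/=; apply/seteqP; split => [x xA i _|x xA i]; first exact: xA.
  by apply: (xA i) => /=; rewrite mem_index_enum.
rewrite -product_measure1E//; last exact: mA.
rewrite [LHS](_ : _ = (lebesgue_rV n \x lebesgue_measure)%E
  (@rV_snoc R n @^-1` [set x | forall i, A i (x ord0 i)]))//.
congr ((_ \x _)%E _).
have wE (j : 'I_n) : lift ord_max j = widen_ord (leqnSn n) j.
  by apply/val_inj; rewrite /= /bump leqNgt ltn_ord.
apply/seteqP; split => -[x t]; rewrite /preimage/=.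
- move=> xtA; split => [j|].
  + by have := xtA (lift ord_max j); rewrite mxE liftK wE.
  + by have := xtA ord_max; rewrite mxE unlift_none.
- move=> [xA tA] i; rewrite mxE; case: unliftP => [j ->|->//].
  by rewrite wE; exact: xA.
Qed.

Section parabolic.
Context {R : realType} (n : nat).

Local Notation V := 'rV[R]_n.+1.
Local Notation mu := (@lebesgue_rV R n.+1).

(* A point x = (x', t) of R^(n+1): t is the last coordinate. *)
Definition space_part (x : V) : 'rV[R]_n :=
  \row_(i < n) x ord0 (widen_ord (leqnSn n) i).

Definition time_part (x : V) : R := x ord0 ord_max.

Definition sqnorm (x : 'rV[R]_n) : R := \sum_(i < n) x ord0 i ^+ 2.

Definition rho (x : V) : R :=
  Num.sqrt ((sqnorm (space_part x) +
    Num.sqrt (sqnorm (space_part x) ^+ 2 + 4 * time_part x ^+ 2)) / 2).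

Definition ellipsoid (x : V) (r : R) : set V :=
  [set y | sqnorm (space_part x - space_part y) / r ^+ 2 +
           (time_part x - time_part y) ^+ 2 / r ^+ 4 < 1].

Definition supp (f : V -> R) : set V := closure [set y | f y != 0].

Definition Lp (p : R) (f : V -> R) : Prop :=
  measurable_fun setT f /\ finite_norm mu p%:E f.

Definition Lp_loc (p : R) (f : V -> R) : Prop :=
  measurable_fun setT f /\
  forall K, compact K -> (\int[mu]_(y in K) (`|f y| `^ p)%:E < +oo)%E.

Definition mean (a : V -> R) (E : set V) : R :=
  (fine (mu E))^-1 * \int[mu]_(y in E) a y.

Definition mean_osc (a : V -> R) (E : set V) : \bar R :=
  ((fine (mu E))^-1%:E * \int[mu]_(y in E) `|a y - mean a E|%:E)%E.

Definition bmo_norm (a : V -> R) : \bar R :=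
  ereal_sup [set mean_osc a (ellipsoid xr.1 xr.2) | xr in [set xr | 0 < xr.2]].

Definition BMO (a : V -> R) : Prop := Lp_loc 1 a /\ (bmo_norm a < +oo)%E.

Definition morrey_norm (p : R) (phi : V -> R -> R) (f : V -> R) : \bar R :=
  ereal_sup [set ((phi xr.1 xr.2)^-1%:E *
      ((xr.2 ^- n.+2)%:E *
       \int[mu]_(y in ellipsoid xr.1 xr.2) (`|f y| `^ p)%:E) `^ p^-1)%E
    | xr in [set xr | 0 < xr.2]].

Definition morrey (p : R) (phi : V -> R -> R) (f : V -> R) : Prop :=
  Lp_loc p f /\ (morrey_norm p phi f < +oo)%E.

Definition essinf_tail (p : R) (phi : V -> R -> R) (x : V) (s : R) : \bar R :=
  ess_inf (mrestr (@lebesgue_measure R) (measurable_itv `]s, +oo[))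
    (fun z => (phi x z * z `^ (n.+2%:R / p))%:E).

(* M_{p,phi} is in general not contained in L_p, where an L_p-bounded operator S
   is given, and the truncations of f in M_{p,phi} to ellipsoids are in L_p.
   The predicate says that f is in L_p or that S f is the extension of S by
   truncation, in the weak sense that |S f| is at most the upper limit of the
   |S (f 1_{E_k(0)})|; for f in L_p, L_p-boundedness and sublinearity of S imply
   this inequality. Without it the values of S outside of L_p are unrelated to
   its values on L_p, and no estimate of S f can follow. *)
Definition determined_on_Lp (p : R) (S : (V -> R) -> (V -> R)) (f : V -> R) :
    Prop :=
  Lp p f \/
  (measurable_fun setT (S f) /\
   {ae mu, forall x, (`|S f x|%:E <=
     limn_esup (fun k : nat =>
       `|S (f \* \1_(ellipsoid (0 : V) k.+1%:R))%R x|%:E))%E}).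

End parabolic.

(* Main.v *)
Require Import Defs.
From mathcomp Require Import all_boot all_order all_algebra finmap.
From mathcomp Require Import all_classical all_reals all_analysis.
From mathcomp Require Import ess_sup_inf measurable_realfun.
From mathcomp Require Import zify ring lra.
Set Implicit Arguments.
Unset Strict Implicit.
Unset Printing Implicit Defensive.
Import Order.TTheory GRing.Theory Num.Theory.
Import numFieldNormedType.Exports HBSimple.
Local Open Scope classical_set_scope.
Local Open Scope ring_scope.

(** Fix an ellipsoid [E] with centre [x0] and radius [r], let [E4] be its dilate of radius
    [4 * r], and split [f] into its near part [f1 = f \* \1_E4] and the rest. Boundedness
    in Lp controls the image of [f1] by the local norm of [f] on [E4]. On [E] the image of
    the far part is controlled by the kernel bound: the complement of [E4] is cut into
    dyadic shells, on which the kernel is comparable to the inverse volume ([rho_far]).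
    With [z] the mean of [a] over [E], the symbol obeys
    [|a x - a y| <= |a x - z| + |a y - z|], and Hoelder's inequality separates [f] from
    [a y - z]. The q-th power mean of [a - z] over the j-th dilate is at most a multiple
    of [j] times the BMO norm: the John-Nirenberg inequality bounds the oscillation about
    the mean over the dilate, and the means over consecutive dilates differ by a multiple
    of the norm ([mean_double_dist], [dyadic_osc]). So the far part is bounded pointwise
    by [|a x - z| + M] times the sum of [j] times the normalized local norms of [f] on the
    dilates ([far_integral]). The weight [j] corresponds to the logarithm in the condition
    on [phi]: the local norms increase with the radius, so their quotients by the Morrey
    norm are below the essential infimum in that condition, and the sum is at most a
    multiple of [phi x0 r] times the Morrey norm of [f] ([morrey_growth]). The p-th power of
    [|a x - z|] is integrated over [E] by the John-Nirenberg inequality again.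

    The John-Nirenberg inequality for p-th powers is proved on dyadic parabolic boxes,
    obtained by halving one side at a time, so that they form a binary tree whose nodes
    have half the volume of their parents. On a finite tree it is combinatorial
    ([tree_john_nirenberg]): walk down from the root until the mean differs from the mean
    at the root by more than a large multiple of the norm. The places where the walk stops
    carry a small part of the mass, the difference there exceeds the threshold by at most
    one jump, and the walk starts anew; by induction on the depth the p-th moment is
    bounded independently of the depth. The bound passes to the function itself since
    integrable functions are L1 limits of dyadic step functions
    ([dyadic_john_nirenberg], [approximable_pbox]), and it passes to ellipsoids because an
    ellipsoid and a box around it have comparable volumes ([john_nirenberg]).

    The kernel bound holds for functions with compact support only. It is applied to
    truncations of the far part, with a bound that does not depend on the truncation; the
    way in which [f] is determined by its truncations or by being in Lp then gives the same
    bound for [f] itself up to a small error. This yields [local_estimate] for each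
    ellipsoid, and the supremum over the ellipsoids is the theorem. The estimates use
    positive upper bounds for the two norms, so that norms that vanish are treated by a
    limit at the end. *)

(** The integral of a nonnegative function is the supremum over the simple
    functions below it, so it is monotone also on integrands whose measurability
    is unclear: the kernel of the operator, the essential infimum of [phi]. *)
Lemma le_nonneg_integral d (X : measurableType d) (R : realType)
    (mu : {measure set X -> \bar R}) (D : set X) (f g : X -> \bar R) :
  (forall x, D x -> 0 <= f x)%E -> (forall x, D x -> f x <= g x)%E ->
  (\int[mu]_(x in D) f x <= \int[mu]_(x in D) g x)%E.
Proof.
move=> f0 fg; rewrite integral_mkcond [leRHS]integral_mkcond.
have fg' x : ((f \_ D) x <= (g \_ D) x)%E by apply: lee_restrict.
have f0' x : (0 <= (f \_ D) x)%E by apply: erestrict_ge0.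
have g0' x : (0 <= (g \_ D) x)%E by exact: le_trans (fg' x).
rewrite !ge0_integralTE//; apply: ereal_sup_le => _ [h hf <-].
by exists h => // y; exact: le_trans (hf y) (fg' y).
Qed.

Lemma le_nonneg_integral_set d (X : measurableType d) (R : realType)
    (mu : {measure set X -> \bar R}) (D E : set X) (f : X -> \bar R) :
  (forall x, 0 <= f x)%E -> D `<=` E ->
  (\int[mu]_(x in D) f x <= \int[mu]_(x in E) f x)%E.
Proof.
move=> f0 DE; rewrite integral_mkcond [leRHS]integral_mkcond.
apply: le_nonneg_integral => x _; rewrite !patchE; case: ifPn => // xD.
- by rewrite ifT//; apply/mem_set/DE/set_mem.
- by case: ifP.
Qed.

Section powR_facts.
Context {R : realType}.
Implicit Types q u v w : R.

Lemma powR_le q u v : 0 <= q -> 0 <= u -> u <= v -> u `^ q <= v `^ q.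
Proof. by move=> q0 u0 uv; rewrite ge0_ler_powR// nnegrE// (le_trans u0). Qed.

Lemma powRD_le q u v : 0 <= q -> 0 <= u -> 0 <= v ->
  (u + v) `^ q <= 2 `^ q * (u `^ q + v `^ q).
Proof.
move=> q0 u0 v0.
wlog uv : u v u0 v0 / u <= v.
  move=> h; have [|/ltW] := leP u v; first exact: h.
  by move=> /h; rewrite addrC [u `^ q + _]addrC; apply.
apply: (@le_trans _ _ ((2 * v) `^ q)).
  by apply: powR_le => //; [exact: addr_ge0|lra].
by rewrite powRM// ler_pM2l ?powR_gt0// lerDr powR_ge0.
Qed.

Lemma powRK q u : q != 0 -> 0 <= u -> (u `^ q) `^ q^-1 = u.
Proof. by move=> q0 u0; rewrite -powRrM mulfV// powRr1. Qed.

Lemma powRVK q u : q != 0 -> 0 <= u -> (u `^ q^-1) `^ q = u.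
Proof. by move=> q0 u0; rewrite -powRrM mulVf// powRr1. Qed.

End powR_facts.

(** * The John-Nirenberg inequality on a binary tree *)

(** A combinatorial model of dyadic subdivision. Each node [b] has two children,
    of half its mass [w b]; [A b] stands for the mean over [b] of a function [a]
    and [J b z] for the integral of [|a - z|] over [b]. *)
Section tree.
Context {R : realType} (B : Type) (ch : bool -> B -> B).

Fixpoint tree_sum (g : B -> R) m (b : B) : R :=
  if m is k.+1 then tree_sum g k (ch false b) + tree_sum g k (ch true b) else g b.

Variables (w A : B -> R) (J : B -> R -> R).
Hypothesis w_gt0 : forall b, 0 < w b.
Hypothesis w_ch : forall i b, w (ch i b) = w b / 2.
Hypothesis J_ch : forall b z, J b z = J (ch false b) z + J (ch true b) z.
Hypothesis J_ge0 : forall b z, 0 <= J b z.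
Hypothesis J_mean : forall b z, w b * `|A b - z| <= J b z.
Variables (M q : R).
Hypothesis M_gt0 : 0 < M.
Hypothesis q_ge1 : 1 <= q.
Hypothesis J_osc : forall b, J b (A b) <= M * w b.

Let q_ge0 : 0 <= q. Proof. exact: le_trans q_ge1. Qed.

(** The q-th moment about [z] of the conditional expectation of [a] at depth [m]. *)
Let moment z m b := tree_sum (fun d => w d * `|A d - z| `^ q) m b.

Let jump i b : `|A (ch i b) - A b| <= 2 * M.
Proof.
have : w (ch i b) * `|A (ch i b) - A b| <= M * w b.
  apply: (le_trans (J_mean _ _)); apply: le_trans (J_osc b).
  by rewrite (J_ch b); case: i; rewrite ?lerDl ?lerDr.
rewrite w_ch => h; have w0 := w_gt0 b.
rewrite -(ler_pM2l w0); lra.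
Qed.

(** The total mass of the nodes at which a walk down the tree first meets a mean
    farther than [lam] from [z], if it stops at depth [m] at the latest. *)
Fixpoint stop_mass (lam z : R) m (b : B) : R :=
  if lam < `|A b - z| then w b else
  if m is k.+1 then stop_mass lam z k (ch false b) + stop_mass lam z k (ch true b)
  else 0.

(** The weak type estimate of the maximal function: [J] is additive, and on each
    stopping node it exceeds [lam] times the mass. *)
Let stop_mass_le lam z m b : lam * stop_mass lam z m b <= J b z.
Proof.
elim: m b => [|m IH] b /=; case: ifPn => [lb|_]; rewrite ?mulr0//.
- by apply: le_trans (J_mean b z); rewrite mulrC ler_pM2l// ltW.
- by apply: le_trans (J_mean b z); rewrite mulrC ler_pM2l// ltW.
- by rewrite mulrDr (J_ch b) lerD.
Qed.

Let w_split b : w b = w (ch false b) + w (ch true b).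
Proof. by rewrite !w_ch -splitr. Qed.

Let moment_shift z m b :
  moment z m b <= 2 `^ q * (moment (A b) m b + w b * `|A b - z| `^ q).
Proof.
suff H c d : moment z m d <= 2 `^ q * (moment c m d + w d * `|c - z| `^ q).
  exact: H.
rewrite /moment; elim: m d => [|m IH] d /=.
  rewrite -mulrDr mulrCA ler_pM2l//.
  apply: le_trans (powRD_le q_ge0 (normr_ge0 _) (normr_ge0 _)).
  by apply: powR_le => //; rewrite (le_trans _ (ler_normD _ _))// addrA subrK.
apply: le_trans (lerD (IH _) (IH _)) _.
by rewrite -mulrDr (w_split d) mulrDl addrACA.
Qed.

(** Away from the stopping nodes the means stay within [lam] of [z]. A stopping node
    is at most one jump [2 * M] beyond [lam], because its parent did not stop; from
    there on the moment about its own mean is bounded by the hypothesis on [K]. *)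
Let moment_stop lam K z m :
  0 <= lam ->
  (forall k b, (k <= m)%N -> moment (A b) k b <= K * w b) ->
  forall b, `|A b - z| <= lam + 2 * M ->
  moment z m b <= lam `^ q * w b +
    stop_mass lam z m b * (2 `^ q * (K + (lam + 2 * M) `^ q)).
Proof.
move=> lam0; elim: m => [|m IH] hK b bz; rewrite [X in _ + X * _]/=; case: ifPn => lb.
1,3: apply: (le_trans (moment_shift z _ b)).
1,2: rewrite [w b * (_ * _)]mulrCA -[X in X <= _]add0r; apply: lerD.
1,3: by rewrite mulr_ge0// ?powR_ge0// ltW.
1,2: rewrite ler_pM2l ?powR_gt0// mulrDr lerD//; first by rewrite mulrC hK.
1,2: by rewrite ler_pM2l//; apply: powR_le.
- rewrite mul0r addr0 /moment/= mulrC ler_pM2r//; apply: powR_le => //.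
  by rewrite leNgt.
- have cz i : `|A (ch i b) - z| <= lam + 2 * M.
    rewrite [leRHS]addrC -(subrK (A b) (A (ch i b))) -addrA.
    apply: le_trans (ler_normD _ _) _.
    by apply: lerD; rewrite ?jump// leNgt.
  have hK' k d : (k <= m)%N -> moment (A d) k d <= K * w d.
    by move=> km; apply: hK; rewrite (leq_trans km).
  rewrite (w_split b) /= /moment /= mulrDr mulrDl addrACA.
  by apply: lerD; exact: IH.
Qed.

(** [lam] is so large that the stopping nodes carry at most [2 `^ - q / 2] of the mass,
    which makes the recursive term of [moment_stop] at most half of the bound. *)
Definition tree_const : R :=
  let lam := 2 `^ q * 2 in 2 * lam `^ q + (lam + 2) `^ q.

(** The bound is uniform in the depth. It is proved by induction on the depth: once
    the walk from [b] has left [b], only smaller depths remain. *)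
Lemma tree_john_nirenberg m b :
  tree_sum (fun d => w d * `|A d - A b| `^ q) m b <= tree_const * M `^ q * w b.
Proof.
pose lam := 2 `^ q * 2 * M.
have lam0 : 0 < lam by rewrite !mulr_gt0// powR_gt0.
pose K := 2 * lam `^ q + (lam + 2 * M) `^ q.
have KE : tree_const * M `^ q = K.
  pose L : R := 2 `^ q * 2; have L0 : 0 <= L by rewrite mulr_ge0// powR_ge0.
  rewrite /K /tree_const -/L (_ : lam = L * M)// -mulrDl.
  by rewrite (powRM _ L0 (ltW M_gt0)) (powRM _ (addr_ge0 L0 _) (ltW M_gt0))//; ring.
rewrite KE -/(moment (A b) m b).
have K0 : 0 <= K by rewrite addr_ge0 ?mulr_ge0 ?powR_ge0.
have [k] := ubnP m; elim: k m b => // k IH m b /ltnSE mk.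
have AAb : ~~ (lam < `|A b - A b|) by rewrite subrr normr0 -leNgt ltW.
case: m mk => [_|m mk].
  by rewrite /moment/= subrr normr0 powR0 ?gt_eqF ?(lt_le_trans ltr01)// mulr0 mulr_ge0// ltW.
rewrite /moment/=.
have cb i : `|A (ch i b) - A b| <= lam + 2 * M.
  by rewrite (le_trans (jump i b))// lerDr ltW.
have hK d e : (d <= m)%N -> moment (A e) d e <= K * w e.
  by move=> dm; apply: IH; rewrite (leq_ltn_trans dm).
apply: (le_trans (lerD (moment_stop (ltW lam0) hK (cb false)) (moment_stop (ltW lam0) hK (cb true)))).
rewrite addrACA -mulrDr -w_split -mulrDl.
have : lam * stop_mass lam (A b) m.+1 b <= M * w b.
  exact: le_trans (stop_mass_le _ _ _ _) (J_osc b).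
rewrite /= (negbTE AAb); set P := _ + _ => hP.
have {hP} : P * (2 `^ q) <= w b / 2.
  by rewrite -(ler_pM2r M_gt0); move: hP; rewrite /lam; lra.
move=> hP.
apply: (@le_trans _ _ (lam `^ q * w b + w b / 2 * (K + (lam + 2 * M) `^ q))).
  rewrite lerD2l mulrA ler_wpM2r// addr_ge0// powR_ge0//.
have := w_gt0 b; rewrite /K; lra.
Qed.

End tree.

Arguments lebesgue_rV : simpl never.

(** * Ellipsoids, cylinders and their volumes *)

Section geometry.
Context {R : realType} (n : nat).

Local Notation V := 'rV[R]_n.+1.
Local Notation mu := (@lebesgue_rV R n.+1).
Local Notation time := (@ord_max n).

Lemma measurable_rV_box (A : 'I_n.+1 -> set R) : (forall i, measurable (A i)) ->
  measurable [set x : V | forall i, A i (x ord0 i)].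
Proof.
move=> mA; rewrite (_ : mkset _ = \bigcap_(i in [set: 'I_n.+1])
    ((fun x : V => x ord0 i) @^-1` A i)).
  apply: fin_bigcap_measurable => // i _.
  by rewrite -[X in measurable X]setTI; exact: measurable_rV_coord.
by apply/seteqP; split => [x xA i _|x xA i]; exact: xA.
Qed.

(** The half-sides of the parabolic cylinder: time scales as the square of space. *)
Definition pradius (r : R) (i : 'I_n.+1) : R := if i == time then r ^+ 2 else r.

Lemma pradius_gt0 r i : 0 < r -> 0 < pradius r i.
Proof. by move=> r0; rewrite /pradius; case: ifP; rewrite ?exprn_gt0. Qed.

Lemma pradius_widen r (i : 'I_n) : pradius r (widen_ord (leqnSn n) i) = r.
Proof. by rewrite /pradius -val_eqE/= ltn_eqF. Qed.

Lemma prod_pradius r : \prod_i pradius r i = r ^+ n.+2.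
Proof.
rewrite big_ord_recr/= {2}/pradius eqxx (eq_bigr (fun=> r)); last first.
  by move=> i _; exact: pradius_widen.
by rewrite prodr_const card_ord -exprD addn2.
Qed.

Definition cylinder (x : V) (r : R) : set V :=
  [set y | forall i, x ord0 i - pradius r i < y ord0 i < x ord0 i + pradius r i].

Lemma cylinderE (x : V) r : cylinder x r = [set y : V | forall i,
  `]x ord0 i - pradius r i, x ord0 i + pradius r i[%classic (y ord0 i)].
Proof. by apply/seteqP; split => y h i; have := h i; rewrite /= in_itv. Qed.

Lemma measurable_cylinder (x : V) r : measurable (cylinder x r).
Proof.
rewrite cylinderE; apply: (measurable_rV_box
  (A := fun i => `]x ord0 i - pradius r i, x ord0 i + pradius r i[%classic)) => i.
exact: measurable_itv.
Qed.

Lemma lebesgue_cylinder (x : V) r : 0 < r ->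
  mu (cylinder x r) = (2 ^+ n.+1 * r ^+ n.+2)%:E.
Proof.
move=> r0; rewrite cylinderE (lebesgue_rV_box
  (A := fun i => `]x ord0 i - pradius r i, x ord0 i + pradius r i[%classic))//.
under eq_bigr => i _.
  have -> : lebesgue_measure
     `]x ord0 i - pradius r i, x ord0 i + pradius r i[%classic =
      (2 * pradius r i)%:E.
    have := pradius_gt0 i r0 => ri0.
    rewrite lebesgue_measure_itv/= lte_fin ifT; last lra.
    by rewrite -EFinB; congr EFin; ring.
  over.
rewrite prodEFin; congr EFin.
by rewrite big_split/= prod_pradius prodr_const card_ord.
Qed.

Local Notation c := (n.+2%:R : R).

Lemma sqnorm_space (x y : V) : sqnorm (space_part x - space_part y) =
  \sum_(i < n) (x ord0 (widen_ord (leqnSn n) i) - y ord0 (widen_ord (leqnSn n) i)) ^+ 2.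
Proof. by apply: eq_bigr => i _; rewrite !mxE. Qed.

Lemma sqnorm_ge0 m (x : 'rV[R]_m) : 0 <= sqnorm x.
Proof. by apply: sumr_ge0 => i _; rewrite sqr_ge0. Qed.

Lemma ellipsoid_cylinder (x : V) r : 0 < r -> ellipsoid x r `<=` cylinder x r.
Proof.
move=> r0 y; rewrite /ellipsoid/= /time_part => h i.
have r2 : 0 < r ^+ 2 by rewrite exprn_gt0.
have r4 : 0 < r ^+ 4 by rewrite exprn_gt0.
have s0 := sqnorm_ge0 (space_part x - space_part y).
have [j ->|->] := unliftP time i; last first.
  rewrite /pradius eqxx.
  have : (x ord0 time - y ord0 time) ^+ 2 / r ^+ 4 < 1.
    by apply: le_lt_trans h; rewrite lerDr divr_ge0// ltW.
  rewrite ltr_pdivrMr// mul1r -(ltr_sqrt)// ?exprn_gt0//.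
  rewrite sqrtr_sqr (_ : 4 = 2 * 2)%N// exprM sqrtr_sqr (gtr0_norm r2).
  by rewrite ltr_norml; lra.
rewrite (_ : lift _ _ = widen_ord (leqnSn n) j); last first.
  by apply/val_inj; rewrite /= /bump leqNgt ltn_ord.
rewrite pradius_widen.
have : sqnorm (space_part x - space_part y) / r ^+ 2 < 1.
  by apply: le_lt_trans h; rewrite lerDl divr_ge0// ?sqr_ge0// ltW.
rewrite ltr_pdivrMr// mul1r => h1.
have : (x ord0 (widen_ord (leqnSn n) j) - y ord0 (widen_ord (leqnSn n) j)) ^+ 2 < r ^+ 2.
  apply: le_lt_trans h1; rewrite sqnorm_space (bigD1 j)//= lerDl.
  by apply: sumr_ge0 => k _; rewrite sqr_ge0.
rewrite -ltr_sqrt// !sqrtr_sqr (gtr0_norm r0) ltr_norml; lra.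
Qed.

(** The factor [n + 2] makes [n / c ^ 2 + 1 / c ^ 4] smaller than 1. *)
Lemma cylinder_ellipsoid (x : V) r : 0 < r -> cylinder x r `<=` ellipsoid x (c * r).
Proof.
move=> r0 y xy; rewrite /ellipsoid/=.
have c0 : 0 < c by [].
have sq i : (x ord0 i - y ord0 i) ^+ 2 <= pradius r i ^+ 2.
  rewrite -ler_sqrt ?sqr_ge0// !sqrtr_sqr (gtr0_norm (pradius_gt0 i r0)).
  by rewrite ler_norml; have := xy i; lra.
have h1 : sqnorm (space_part x - space_part y) / (c * r) ^+ 2 <= n%:R / c ^+ 2.
  rewrite exprMn invfM mulrA mulrAC ler_pM2r ?invr_gt0 ?exprn_gt0//.
  rewrite ler_pdivrMr ?exprn_gt0// sqnorm_space.
  apply: (@le_trans _ _ (\sum_(i < n) r ^+ 2)).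
    by apply: ler_sum => i _; apply: (le_trans (sq _)); rewrite pradius_widen.
  by rewrite sumr_const card_ord mulr_natl.
have h2 : (time_part x - time_part y) ^+ 2 / (c * r) ^+ 4 <= 1 / c ^+ 4.
  rewrite exprMn invfM mulrA mulrAC ler_pM2r ?invr_gt0 ?exprn_gt0//.
  rewrite ler_pdivrMr ?exprn_gt0// mul1r.
  by apply: (le_trans (sq _)); rewrite /pradius eqxx -exprM.
apply: (le_lt_trans (lerD h1 h2)).
have c2 : 2 <= c by rewrite ler_nat.
have h3 : 1 / c ^+ 4 <= 1 / c ^+ 2.
  by rewrite ler_pM2l// lef_pV2 ?posrE ?exprn_gt0// ler_weXn2l// (le_trans _ c2)// ler1n.
have h4 : n%:R + 1 < c ^+ 2.
  have : n%:R + 1 < c by rewrite natr1 ltr_nat.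
  move=> /lt_le_trans; apply; rewrite expr2 ler_peMl//; lra.
apply: (le_lt_trans (lerD (lexx _) h3)).
by rewrite -mulrDl ltr_pdivrMr ?exprn_gt0// mul1r.
Qed.

Lemma measurable_ellipsoid (x : V) r : measurable (ellipsoid x r).
Proof.
have mc i : measurable_fun setT (fun y : V => y ord0 i) by exact: measurable_rV_coord.
pose g (y : V) := sqnorm (space_part x - space_part y) / r ^+ 2 +
           (time_part x - time_part y) ^+ 2 / r ^+ 4.
have mg : measurable_fun setT g.
  apply: measurable_funD; apply: measurable_funM => //.
    rewrite (_ : (fun _ => _) = fun y : V => \sum_(i < n)
      (x ord0 (widen_ord (leqnSn n) i) - y ord0 (widen_ord (leqnSn n) i)) ^+ 2).
      apply: measurable_sum => i; apply: measurable_funX.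
      exact: measurable_funB.
    by apply/funext => y; exact: sqnorm_space.
  by apply: measurable_funX; apply: measurable_funB => //; exact: mc.
rewrite (_ : ellipsoid x r = setT `&` g @^-1` `]-oo, 1[%classic).
  by apply: mg => //.
by apply/seteqP; split => y /=; rewrite in_itv/=; [split|case].
Qed.

Lemma lebesgue_ellipsoid_le (x : V) r : 0 < r ->
  (mu (ellipsoid x r) <= (2 ^+ n.+1 * r ^+ n.+2)%:E)%E.
Proof.
move=> r0; rewrite -(lebesgue_cylinder x r0).
apply: le_measure; rewrite ?inE; [exact: measurable_ellipsoid|
  exact: measurable_cylinder|exact: ellipsoid_cylinder].
Qed.

Lemma lebesgue_ellipsoid_ge (x : V) r : 0 < r ->
  ((2 ^+ n.+1 * (r / c) ^+ n.+2)%:E <= mu (ellipsoid x r))%E.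
Proof.
move=> r0; have rc0 : 0 < r / c by rewrite divr_gt0.
rewrite -(lebesgue_cylinder x rc0).
apply: le_measure; rewrite ?inE; [
  exact: measurable_cylinder|exact: measurable_ellipsoid|].
have := @cylinder_ellipsoid x _ rc0.
by rewrite mulrCA mulfV// mulr1.
Qed.

Lemma closed_box_compact (x : V) r :
  compact [set y : V | forall i, `[x ord0 i - pradius r i, x ord0 i + pradius r i]%classic (y ord0 i)].
Proof.
apply: (@rV_compact _ _ (fun i => `[x ord0 i - pradius r i, x ord0 i + pradius r i]%classic)) => i.
exact: segment_compact.
Qed.

Definition vol (x : V) (r : R) : R := fine (mu (ellipsoid x r)).

Lemma lebesgue_ellipsoid_fin (x : V) r : 0 < r -> mu (ellipsoid x r) \is a fin_num.
Proof.
move=> r0; rewrite ge0_fin_numE//.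
by apply: le_lt_trans (lebesgue_ellipsoid_le x r0) _; rewrite ltry.
Qed.

Lemma volE (x : V) r : 0 < r -> mu (ellipsoid x r) = (vol x r)%:E.
Proof. by move=> r0; rewrite fineK// lebesgue_ellipsoid_fin. Qed.

Lemma vol_le (x : V) r : 0 < r -> vol x r <= 2 ^+ n.+1 * r ^+ n.+2.
Proof. by move=> r0; rewrite -lee_fin -volE// lebesgue_ellipsoid_le. Qed.

Lemma vol_ge (x : V) r : 0 < r -> 2 ^+ n.+1 * (r / c) ^+ n.+2 <= vol x r.
Proof. by move=> r0; rewrite -lee_fin -volE// lebesgue_ellipsoid_ge. Qed.

Lemma vol_gt0 (x : V) r : 0 < r -> 0 < vol x r.
Proof.
by move=> r0; apply: lt_le_trans (vol_ge x r0); rewrite mulr_gt0 ?exprn_gt0 ?divr_gt0.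
Qed.

(** Parabolic boxes are halved one side at a time, cyclically: the [n] space sides
    once and the time side twice in each period of [n + 2] steps. *)
Definition split_dir (k : nat) : 'I_n.+1 := inord (minn (k %% n.+2) n).

(** The number of steps before the [k]-th that halve the side [i]. *)
Definition halvings (k : nat) (i : 'I_n.+1) : nat :=
  if i == time then (k %/ n.+2 + k.+1 %/ n.+2)%N else ((k + (n.+1 - i)) %/ n.+2)%N.

Lemma dvdn_addS (k j : nat) : (j < n.+2)%N ->
  (n.+2 %| k + (n.+2 - j))%N = (k %% n.+2 == j)%N.
Proof.
move=> jn; rewrite /dvdn -[in RHS](modn_small jn) -(eqn_modDr (n.+2 - j)) subnKC 1?ltnW//.
by rewrite modnn.
Qed.

Lemma halvingsS k i : halvings k.+1 i = (halvings k i + (i == split_dir k))%N.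
Proof.
have kn : (k %% n.+2 < n.+2)%N by rewrite ltn_mod.
have sd : split_dir k = minn (k %% n.+2) n :> nat.
  by rewrite /split_dir inordK// ltnS geq_minr.
have eqE (a b : 'I_n.+1) : (a == b) = (a == b :> nat) by [].
rewrite /halvings !eqE sd; have := ltn_ord i; rewrite ltnS leq_eqVlt [nat_of_ord time]/=.
case/predU1P => [->|iltn].
  rewrite eqxx !divnS//.
  have e1 : (n.+2 %| k.+1)%N = (k %% n.+2 == n.+1)%N.
    by rewrite -(@dvdn_addS k n.+1)// subSnn addn1.
  have e2 : (n.+2 %| k.+2)%N = (k %% n.+2 == n)%N.
    by rewrite -(@dvdn_addS k n)// (_ : n.+2 - n = 2)%N ?addn2//; lia.
  rewrite e1 e2; move: kn; move: (k %% n.+2)%N (k %/ n.+2)%N => a b ab; lia.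
rewrite (ltn_eqF iltn) addSn divnS// -addnS -subSn; last by rewrite ltnW// ltnS.
rewrite dvdn_addS; last by rewrite (ltn_trans iltn).
rewrite addnC; congr (_ + nat_of_bool _)%N.
by move: kn iltn; move: (k %% n.+2)%N (nat_of_ord i) => a b; lia.
Qed.

Lemma halvings_space k i : i != time ->
  (k %/ n.+2 <= halvings k i <= (k %/ n.+2).+1)%N.
Proof.
move=> /negbTE it; rewrite /halvings it; apply/andP; split.
  by apply: leq_div2r; rewrite leq_addr.
apply: (@leq_trans ((k + n.+2) %/ n.+2)%N); first by apply: leq_div2r; lia.
by rewrite divnDr// divnn addn1.
Qed.

Lemma halvings_time k :
  ((k %/ n.+2).*2 <= halvings k time <= (k %/ n.+2).*2.+1)%N.
Proof.
rewrite /halvings eqxx divnS//.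
by case: (_ %| _)%N; lia.
Qed.

End geometry.

(** * Dyadic approximation *)

Section integral_tools.
Context d (T : measurableType d) (R : realType) (mu : {measure set T -> \bar R}).
Implicit Types (D : set T) (f g h : T -> R).

Lemma le_integralD D f g h : measurable D ->
  measurable_fun D g -> measurable_fun D h ->
  (forall x, D x -> 0 <= g x) -> (forall x, D x -> 0 <= h x) ->
  (forall x, D x -> 0 <= f x) -> (forall x, D x -> f x <= g x + h x) ->
  (\int[mu]_(x in D) (f x)%:E <=
   \int[mu]_(x in D) (g x)%:E + \int[mu]_(x in D) (h x)%:E)%E.
Proof.
move=> mD mg mh g0 h0 f0 fgh; rewrite -ge0_integralD//; last 2 first.
- exact/measurable_EFinP.
- exact/measurable_EFinP.
apply: le_nonneg_integral => x Dx; first by rewrite lee_fin f0.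
by rewrite -EFinD lee_fin fgh.
Qed.

Lemma integralZ_EFin D f k : measurable D -> measurable_fun D f ->
  (forall x, D x -> 0 <= f x) -> 0 <= k ->
  (\int[mu]_(x in D) (k * f x)%:E = k%:E * \int[mu]_(x in D) (f x)%:E)%E.
Proof.
move=> mD mf f0 k0; under eq_integral do rewrite EFinM.
by rewrite ge0_integralZl_EFin//; exact/measurable_EFinP.
Qed.

Lemma integrable_cst_fin D (z : R) : measurable D -> (mu D < +oo)%E ->
  mu.-integrable D (EFin \o cst z).
Proof.
move=> mD Dfin; apply/integrableP; split; first exact/measurable_EFinP.
under eq_integral do rewrite /=; rewrite integral_cst//=.
by apply: lte_mul_pinfty.
Qed.

End integral_tools.

(** A binary tree of sets [S b], each the disjoint union of two children of half its
    measure. *)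
Section dyadic.
Context d (T : measurableType d) (R : realType) (mu : {measure set T -> \bar R}).
Variables (B : Type) (ch : bool -> B -> B) (S : B -> set T) (w : B -> R).
Hypothesis mS : forall b, measurable (S b).
Hypothesis S_ch : forall b, S b = S (ch false b) `|` S (ch true b).
Hypothesis S_disj : forall b, [disjoint S (ch false b) & S (ch true b)].
Hypothesis mu_S : forall b, mu (S b) = (w b)%:E.
Hypothesis w_gt0 : forall b, 0 < w b.
Hypothesis w_ch : forall i b, w (ch i b) = w b / 2.
Implicit Types (b : B) (f g h : T -> R).

Lemma integral_children b f : measurable_fun setT f ->
  (forall x, 0 <= f x) ->
  (\int[mu]_(x in S b) (f x)%:E =
   \int[mu]_(x in S (ch false b)) (f x)%:E + \int[mu]_(x in S (ch true b)) (f x)%:E)%E.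
Proof.
move=> mf f0; rewrite [in LHS]S_ch ge0_integral_setU//.
- by apply/measurable_EFinP; exact: measurable_funTS.
- by move=> x _; rewrite lee_fin.
Qed.

(** [h] is constant on each descendant of [b] at depth [m]. *)
Fixpoint step_on m b h : Prop :=
  if m is k.+1 then step_on k (ch false b) h /\ step_on k (ch true b) h
  else exists c, forall x, S b x -> h x = c.

Let S_sub i b : S (ch i b) `<=` S b.
Proof. by rewrite (S_ch b); case: i => x ?; [right|left]. Qed.

Lemma eq_step_on m b g h : (forall x, S b x -> g x = h x) ->
  step_on m b g -> step_on m b h.
Proof.
elim: m b => [|m IH] b /= gh.
  by move=> [c gc]; exists c => x xb; rewrite -gh// gc.
by move=> [g0 g1]; split; [apply: IH g0|apply: IH g1] => x /S_sub/gh.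
Qed.

Lemma step_onS m b h : step_on m b h -> step_on m.+1 b h.
Proof.
elim: m b => [|m IH] b /=; last by move=> [? ?]; split; apply: IH.
move=> [c hc]; split; exists c => x xb; apply: hc; rewrite S_ch; by [left|right].
Qed.

Lemma step_on_leq m k b h : (m <= k)%N -> step_on m b h -> step_on k b h.
Proof.
move=> /subnKC <-; elim: (k - m)%N => [|j IH]; first by rewrite addn0.
by move=> /IH; rewrite addnS; apply: step_onS.
Qed.

Lemma step_on2 (op : R -> R -> R) m b g h :
  step_on m b g -> step_on m b h -> step_on m b (fun x => op (g x) (h x)).
Proof.
elim: m b => [|m IH] b /=.
  by move=> [c gc] [e he]; exists (op c e) => x xb; rewrite gc// he.
by move=> [? ?] [? ?]; split; apply: IH.
Qed.

(** Approximability in L1 by dyadic step functions replaces the Lebesgue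
    differentiation theorem: it suffices to pass to the limit in the bounds for
    conditional expectations. *)
Definition approximable b f := forall e, 0 < e -> exists m h,
  [/\ measurable_fun setT h, step_on m b h &
      (\int[mu]_(x in S b) `|f x - h x|%:E <= e%:E)%E].

Let mdist b f h : measurable_fun setT f -> measurable_fun setT h ->
  measurable_fun (S b) (fun x => `|f x - h x|).
Proof.
move=> mf mh; apply: measurable_funTS; apply: measurableT_comp => //.
exact: measurable_funB.
Qed.

Lemma approximable_op2 (op : R -> R -> R) b f g :
  (forall u v, measurable_fun setT u -> measurable_fun setT v ->
    measurable_fun setT (fun x : T => op (u x) (v x))) ->
  (forall s t s' t', `|op s t - op s' t'| <= `|s - s'| + `|t - t'|) ->
  measurable_fun setT f -> measurable_fun setT g ->
  approximable b f -> approximable b g -> approximable b (fun x => op (f x) (g x)).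
Proof.
move=> mop opL mf mg hf hg e e0.
have e20 : 0 < e / 2 by rewrite divr_gt0.
have [m [u [mu_ su fu]]] := hf _ e20; have [k [v [mv sv gv]]] := hg _ e20.
exists (maxn m k), (fun x => op (u x) (v x)); split; first exact: mop.
  apply: step_on2; apply: step_on_leq; [exact: leq_maxl|exact: su|exact: leq_maxr|exact: sv].
rewrite [e]splitr EFinD; apply: le_trans (leeD fu gv).
by apply: le_integralD => //; [exact: mdist|exact: mdist].
Qed.

Lemma approximable_cst b (c : R) : approximable b (fun=> c).
Proof.
move=> e e0; exists 0%N, (fun=> c); split => //; first by exists c.
by under eq_integral do rewrite subrr normr0; rewrite integral0 lee_fin ltW.
Qed.

Lemma approximableD b f g : measurable_fun setT f -> measurable_fun setT g ->
  approximable b f -> approximable b g -> approximable b (fun x => f x + g x).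
Proof.
apply: (approximable_op2 (op := +%R)) => [u v|s t s' t'].
  exact: measurable_funD.
by rewrite opprD addrACA ler_normD.
Qed.

Lemma approximable_max b f g : measurable_fun setT f -> measurable_fun setT g ->
  approximable b f -> approximable b g ->
  approximable b (fun x => Num.max (f x) (g x)).
Proof.
apply: (approximable_op2 (op := Num.max)) => [u v|s t s' t'].
  exact: measurable_maxr.
have := ler_norm (s - s'); have := ler_norm (t - t').
have := ler_norm (s' - s); have := ler_norm (t' - t).
rewrite (distrC s') (distrC t') => h1 h2 h3 h4.
have := normr_ge0 (s - s'); have := normr_ge0 (t - t') => h5 h6.
rewrite ler_norml.
by case: (leP s t) => ?; case: (leP s' t') => ?; apply/andP; split; lra.
Qed.

Lemma approximableZ b f (c : R) : measurable_fun setT f ->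
  approximable b f -> approximable b (fun x => c * f x).
Proof.
move=> mf hf e e0.
have c0 : 0 < `|c| + 1 by rewrite ltr_wpDl.
have [m [h [mh sh fh]]] := hf (e / (`|c| + 1)) (divr_gt0 e0 c0).
exists m, (fun x => c * h x); split; first exact: measurable_funM.
  exact: (step_on2 (fun s _ => c * s) sh sh).
have le_c x : `|c * f x - c * h x| <= (`|c| + 1) * `|f x - h x|.
  by rewrite -mulrBr normrM ler_wpM2r// lerDl.
apply: (@le_trans _ _ (\int[mu]_(x in S b) ((`|c| + 1) * `|f x - h x|)%:E)%E).
  by apply: le_nonneg_integral => x _; rewrite lee_fin.
rewrite integralZ_EFin//; last exact: mdist.
apply: (@le_trans _ _ ((`|c| + 1)%:E * (e / (`|c| + 1))%:E)%E).
  by apply: lee_wpmul2l => //; rewrite lee_fin ltW.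
by rewrite -EFinM lee_fin mulrCA mulfV ?mulr1// gt_eqF.
Qed.

Lemma approximable_lim b f : measurable_fun setT f ->
  (forall e, 0 < e -> exists g, [/\ measurable_fun setT g, approximable b g &
     (\int[mu]_(x in S b) `|f x - g x|%:E <= e%:E)%E]) -> approximable b f.
Proof.
move=> mf hf e e0; have e20 : 0 < e / 2 by rewrite divr_gt0.
have [g [mg ag fg]] := hf _ e20; have [m [h [mh sh gh]]] := ag _ e20.
exists m, h; split => //; rewrite [e]splitr EFinD; apply: le_trans (leeD fg gh).
apply: le_integralD => //; [exact: mdist|exact: mdist|move=> x _].
by rewrite (le_trans _ (ler_normD _ _))// addrA subrK.
Qed.

(** It is therefore enough to approximate a generating family of sets. Finite unions
    are maxima of indicators, and a countable union is approached in measure by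
    finite ones since [S b] has finite measure. *)
Lemma sigma_algebra_approximable b : sigma_algebra setT
  [set A | measurable A /\ approximable b (\1_A : T -> R)].
Proof.
split => /=.
- by split => //; rewrite indic0; exact: approximable_cst.
- move=> A [mA aA]; split; first by rewrite setTD; exact: measurableC.
  rewrite (_ : \1_(_ `\` _) = fun x => 1 + (-1) * \1_A x).
    apply: approximableD => //.
    + by apply: measurable_funM => //.
    + exact: approximable_cst.
    + by apply: approximableZ.
  apply/funext => x; rewrite setTD !indicE in_setC.
  by case: (x \in A); rewrite /= mulN1r ?subrr ?subr0.
move=> A hA; have mA k : measurable (A k) by have [] := hA k.
have mcup : measurable (\bigcup_k A k) by exact: bigcup_measurable.
split => //; pose U k := \big[setU/set0]_(i < k) A i.
have mU k : measurable (U k) by exact: bigsetU_measurable.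
have aU k : approximable b (\1_(U k) : T -> R).
  elim: k => [|k IH]; first by rewrite /U big_ord0 indic0; exact: approximable_cst.
  rewrite /U big_ord_recr/= -/(U k).
  rewrite (_ : \1_(_ `|` _) = fun x => Num.max (\1_(U k) x : R) (\1_(A k) x)).
    by apply: approximable_max => //; have [] := hA k.
  apply/funext => x; rewrite !indicE in_setU.
  by case: (x \in U k); case: (x \in A k); rewrite /= ?maxxx//;
    apply/esym; [exact/max_idPl/ler01|exact/max_idPr/ler01].
apply: approximable_lim => // e e0.
pose F k := (\bigcup_i A i `\` U k) `&` S b.
have mF k : measurable (F k) by apply: measurableI => //; exact: measurableD.
have F0 : \bigcap_k F k = set0.
  rewrite -subset0 => x /= xF; have [[[i _ Aix] _] _] := xF 0%N I.
  have [[_ +] _] := xF i.+1 I; apply; rewrite /U big_ord_recr/=; by right.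
have : mu \o F @ \oo --> mu (\bigcap_k F k).
  apply: nonincreasing_cvg_mu => //.
  - apply: (@le_lt_trans _ _ (mu (S b))); last by rewrite mu_S ltry.
    by apply: le_measure; rewrite ?inE//; exact: subIsetr.
  - exact: bigcap_measurable.
  - move=> i j ij; apply/subsetPset; apply: setSI; apply: setDS.
    exact: subset_bigsetU.
rewrite F0 measure0 => /fine_cvgP[Ffin /cvgrPdist_lt/(_ _ e0) Fe].
near \oo => k; exists (\1_(U k)); split => //.
rewrite (eq_integral (fun x => (\1_(\bigcup_i A i `\` U k) x)%:E)); last first.
  move=> x _; congr EFin.
  have : U k `<=` \bigcup_i A i by rewrite /U -bigcup_mkord => y [i _ ?]; exists i.
  move=> UA; rewrite !indicE in_setD.
  have [xU|xU] := boolP (x \in U k).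
    have -> : x \in \bigcup_i A i by apply/mem_set/UA/set_mem.
    by rewrite subrr normr0.
  by rewrite andbT subr0 normr_nat.
rewrite integral_indic//; last exact: measurableD.
rewrite -/(F k) -[leLHS]fineK; last by near: k; exact: Ffin.
rewrite lee_fin (le_trans (ler_norm _))// ltW//.
have : `|0 - fine (mu (F k))| < e by near: k; exact: Fe.
by rewrite sub0r normrN.
Unshelve. all: by end_near. Qed.

Hypothesis approximable_indic : forall b A,
  measurable A -> approximable b (\1_A : T -> R).

Lemma approximable_sfun b (g : {sfun T >-> R}) : approximable b g.
Proof.
rewrite (_ : (g : T -> R) = fun x => \sum_(r <- fset_set (range g)) (r * \1_(g @^-1` [set r]) x)).
  elim: (fset_set (range g) : seq R) => [|r s IH].
    under eq_fun do rewrite big_nil; exact: approximable_cst.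
  under eq_fun do rewrite big_cons.
  have mi t : measurable_fun setT (\1_(g @^-1` [set t]) : T -> R) by [].
  apply: approximableD => //.
  - exact: measurable_funM.
  - by apply: measurable_sum => t; exact: measurable_funM.
  - by apply: approximableZ => //; exact: approximable_indic.
by apply/funext => x; rewrite fimfunE fsbig_finite.
Qed.

Lemma approximable_integrable b f : measurable_fun setT f ->
  mu.-integrable (S b) (EFin \o f) -> approximable b f.
Proof.
move=> mf fi; apply: approximable_lim => // e e0.
have [g_ [gi _]] := approximation_sfun_integrable (mS b) fi.
move=> /fine_cvgP[gfin /cvgrPdist_lt/(_ _ e0) ge].
near \oo => k; exists (g_ k); split => //; first exact: approximable_sfun.
rewrite -[leLHS]fineK; last by near: k; exact: gfin.
rewrite lee_fin (le_trans (ler_norm _))// ltW//.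
have : `|0 - fine (\int[mu]_(z in S b) `|(f z)%:E - (g_ k z)%:E|)| < e by near: k; exact: ge.
by rewrite sub0r normrN.
Unshelve. all: by end_near. Qed.

Variables (a : T -> R).
Hypothesis ma : measurable_fun setT a.
Hypothesis ia : forall b, mu.-integrable (S b) (EFin \o a).

Let avg b : R := (w b)^-1 * \int[mu]_(x in S b) a x.
Let dev b z : R := \int[mu]_(x in S b) `|a x - z|.

Let icst b (z : R) : mu.-integrable (S b) (EFin \o cst z).
Proof. by apply: integrable_cst_fin => //; rewrite mu_S ltry. Qed.

Let iaz b z : mu.-integrable (S b) (fun x => (a x - z)%:E).
Proof. by under eq_fun do rewrite EFinB; apply: integrableB => //; exact: icst. Qed.

Let mdev b z : measurable_fun (S b) (fun x => `|a x - z|).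
Proof. by apply: measurable_funTS; apply: measurableT_comp => //; exact: measurable_funB. Qed.

Let devE b z : (\int[mu]_(x in S b) `|a x - z|%:E = (dev b z)%:E)%E.
Proof.
rewrite /dev /Rintegral fineK//; apply: integrable_fin_num => //.
exact: (integrable_norm (iaz b z)).
Qed.

Let dev_ge0 b z : 0 <= dev b z.
Proof. by apply: Rintegral_ge0. Qed.

Let dev_ch b z : dev b z = dev (ch false b) z + dev (ch true b) z.
Proof.
apply/EFin_inj; rewrite EFinD -!devE; apply: integral_children => //.
by apply: measurableT_comp => //; exact: measurable_funB.
Qed.

Let dev_avg b z : w b * `|avg b - z| <= dev b z.
Proof.
have w0 := w_gt0 b.
rewrite -[w b in X in X <= _]gtr0_norm// -normrM mulrBr /avg mulrA mulfV ?gt_eqF// mul1r.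
rewrite (_ : w b * z = \int[mu]_(x in S b) (cst z x)); last first.
  by rewrite Rintegral_cst// mu_S mulrC.
rewrite -RintegralB//; by apply: le_normr_Rintegral => //; exact: iaz.
Qed.

Let int_cst b r : (\int[mu]_(x in S b) (cst r x)%:E = (r * w b)%:E)%E.
Proof. by rewrite (integral_cst mu (mS b) r%:E) mu_S -EFinM. Qed.

(** The mean is the best constant up to a factor 2. *)
Let dev_avg_le b c : dev b (avg b) <= 2 * dev b c.
Proof.
rewrite mulr_natl mulr2n -lee_fin EFinD -!devE; apply: (@le_trans _ _
  (\int[mu]_(x in S b) `|a x - c|%:E + \int[mu]_(x in S b) (cst `|avg b - c| x)%:E)%E).
  apply: le_integralD => // x _; rewrite (distrC (avg b) c).
  by rewrite (le_trans _ (ler_normD _ _))// addrA subrK.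
by rewrite int_cst devE leeD2l// lee_fin mulrC dev_avg.
Qed.

Variables (M q : R).
Hypothesis M_gt0 : 0 < M.
Hypothesis q_ge1 : 1 <= q.
Hypothesis osc : forall b, exists c, (\int[mu]_(x in S b) `|a x - c|%:E <= (M * w b)%:E)%E.

Let osc_avg b : dev b (avg b) <= 2 * M * w b.
Proof.
have [c] := osc b; rewrite devE lee_fin => h.
by rewrite (le_trans (dev_avg_le b c))// -mulrA ler_pM2l.
Qed.

Let q_ge0 : 0 <= q. Proof. exact: le_trans q_ge1. Qed.

(** On each descendant [d] at depth [m] the mean is compared with [a]: the truncation
    at [N] turns the q-th power of [|a - avg d|] into a multiple of its first power,
    hence of the L1 distance from [a] to the step function [h]. *)
Let truncated_moment N z m b h : 0 <= N -> measurable_fun setT h -> step_on m b h ->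
  (\int[mu]_(x in S b) (Num.min `|a x - z| N `^ q)%:E <=
   (2 `^ q * tree_sum ch (fun d => w d * `|avg d - z| `^ q) m b)%:E +
   (2 `^ q * N `^ (q - 1) * 2)%:E * \int[mu]_(x in S b) `|a x - h x|%:E)%E.
Proof.
move=> N0 mh; elim: m b => [|m IH] b /=.
  move=> [c hc].
  have -> : (\int[mu]_(x in S b) `|a x - h x|%:E = (dev b c)%:E)%E.
    by rewrite -devE; apply: eq_integral => x /set_mem/hc ->.
  have K0 : 0 <= 2 `^ q * N `^ (q - 1) by rewrite mulr_ge0 ?powR_ge0.
  apply: (@le_trans _ _ (\int[mu]_(x in S b) (cst (2 `^ q * `|avg b - z| `^ q) x)%:E +
     \int[mu]_(x in S b) (2 `^ q * N `^ (q - 1) * `|a x - avg b|)%:E)%E).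
    apply: le_integralD => //.
    - by apply: measurable_funM.
    - by move=> x _; rewrite mulr_ge0 ?powR_ge0.
    - by move=> x _; rewrite mulr_ge0.
    - by move=> x _; exact: powR_ge0.
    move=> x _ /=; rewrite -mulrA -mulrDr.
    set u := `|avg b - z|; set v := `|a x - avg b|.
    have uv : `|a x - z| <= u + v.
      by rewrite [u + v]addrC; have := ler_normD (a x - avg b) (avg b - z); rewrite addrA subrK.
    have u0 : 0 <= u by exact: normr_ge0.
    have v0 : 0 <= v by exact: normr_ge0.
    have mv0 : 0 <= Num.min v N by rewrite le_min v0.
    apply: (@le_trans _ _ ((u + Num.min v N) `^ q)).
      apply: powR_le => //; first by rewrite le_min normr_ge0.
      have [vN|vN] := leP v N; first by rewrite ge_min uv.
      by rewrite ge_min; apply/orP; right; rewrite lerDr.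
    apply: (le_trans (powRD_le q_ge0 u0 mv0)).
    rewrite ler_pM2l ?powR_gt0// lerD2l -mulr_powRB1// ?(lt_le_trans ltr01)//.
    rewrite mulrC; apply: ler_pM => //; rewrite ?powR_ge0//; last by rewrite ge_min lexx.
    by apply: powR_le => //; [rewrite subr_ge0|rewrite ge_min lexx orbT].
  rewrite int_cst integralZ_EFin// devE -!EFinM -!EFinD lee_fin.
  rewrite [w b * _]mulrC mulrA lerD2l -(mulrA _ 2 (dev b c)) ler_wpM2l//.
move=> [sh0 sh1]; rewrite integral_children//; last 2 first.
- apply: (measurableT_comp (measurable_powR q)); apply: measurable_minr => //.
  by apply: measurableT_comp => //; exact: measurable_funB.
- by move=> x; exact: powR_ge0.
rewrite (@integral_children b (fun x => `|a x - h x|))//; last first.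
  by apply: measurableT_comp => //; exact: measurable_funB.
apply: (le_trans (leeD (IH _ sh0) (IH _ sh1))).
rewrite [X in (_ <= _ + X)%E]ge0_muleDr; last 2 first.
- by apply: integral_ge0 => x _; rewrite lee_fin.
- by apply: integral_ge0 => x _; rewrite lee_fin.
by rewrite addeACA -EFinD -mulrDr.
Qed.

(** The combinatorial bound passes to [a]: first the depth tends to infinity, along
    dyadic approximations of [a], then the truncation level does. *)
Lemma dyadic_john_nirenberg b :
  (\int[mu]_(x in S b) (`|a x - avg b| `^ q)%:E <=
   (2 `^ q * (tree_const q * (2 * M) `^ q) * w b)%:E)%E.
Proof.
have tr N : 0 <= N -> (\int[mu]_(x in S b) (Num.min `|a x - avg b| N `^ q)%:E <=
   (2 `^ q * (tree_const q * (2 * M) `^ q) * w b)%:E)%E.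
  move=> N0; apply/lee_addgt0Pr => e e0.
  pose c := 2 `^ q * N `^ (q - 1) * 2.
  have c0 : 0 <= c by rewrite !mulr_ge0// powR_ge0.
  have c10 : 0 < c + 1 by rewrite ltr_wpDl.
  have aa : approximable b a.
    exact: approximable_integrable.
  have [m [h [mh sh ah]]] := aa (e / (c + 1)) (divr_gt0 e0 c10).
  apply: (le_trans (truncated_moment (avg b) N0 mh sh)); apply: leeD.
    rewrite lee_fin -mulrA ler_pM2l ?powR_gt0//.
    exact: (tree_john_nirenberg w_gt0 w_ch dev_ch dev_ge0 dev_avg (mulr_gt0 (ltr0Sn _ 1) M_gt0) q_ge1 osc_avg).
  apply: (@le_trans _ _ (c%:E * (e / (c + 1))%:E)%E); first exact: lee_wpmul2l.
  rewrite -EFinM lee_fin mulrCA ger_pMr// ler_pdivrMr// mul1r lerDl//.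
pose g k x := (Num.min `|a x - avg b| k%:R `^ q)%:E : \bar R.
have gg k : (\int[mu]_(x in S b) g k x <= (2 `^ q * (tree_const q * (2 * M) `^ q) * w b)%:E)%E.
  exact: tr.
rewrite (eq_integral (fun x => limn (g^~ x))); last first.
  move=> x _; apply/esym/cvg_lim => //.
  apply/cvg_ballP => e e0.
  near=> k; rewrite /g min_l; first exact: ballxx.
  rewrite ltW//; near: k; exact: nbhs_infty_gtr.
rewrite monotone_convergence//.
- apply: lime_le.
    apply: ereal_nondecreasing_is_cvgn => i j ij; apply: le_nonneg_integral => x _.
      by rewrite lee_fin powR_ge0.
    rewrite lee_fin; apply: powR_le => //.
    by rewrite le_min ge_min lexx/= ge_min ler_nat ij orbT.
  by near=> k.
- move=> k; apply/measurable_EFinP; apply: measurable_funTS.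
  apply: (measurableT_comp (measurable_powR q)); apply: measurable_minr => //.
  by apply: measurableT_comp => //; exact: measurable_funB.
- by move=> k x _; rewrite lee_fin powR_ge0.
move=> x _ i j ij; rewrite lee_fin; apply: powR_le => //.
by rewrite le_min ge_min lexx/= ge_min ler_nat ij orbT.
Unshelve. all: by end_near. Qed.

End dyadic.

(** * Dyadic parabolic boxes *)

Section parabolic_boxes.
Context {R : realType} (n : nat).

Local Notation V := 'rV[R]_n.+1.
Local Notation mu := (@lebesgue_rV R n.+1).
Local Notation time := (@ord_max n).
Variable s : R.
Hypothesis s_gt0 : 0 < s.

Local Notation box_index := (nat * ('I_n.+1 -> R))%type.

(** All boxes of the same generation are translates of each other, so that a box is
    given by its generation and its lower corner. *)
Definition side (k : nat) (i : 'I_n.+1) : R := pradius s i / 2 ^+ halvings k i.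

Definition pbox (b : box_index) : set V :=
  [set x | forall i, `[b.2 i, b.2 i + side b.1 i[%classic (x ord0 i)].

Definition child (j : bool) (b : box_index) : box_index :=
  (b.1.+1, fun i => b.2 i + (if j && (i == split_dir n b.1) then side b.1.+1 i else 0)).

Definition box_volume (b : box_index) : R := \prod_i side b.1 i.

Lemma side_gt0 k i : 0 < side k i.
Proof. by rewrite divr_gt0 ?pradius_gt0// exprn_gt0. Qed.

Lemma sideS k i : side k.+1 i = if i == split_dir n k then side k i / 2 else side k i.
Proof.
rewrite /side halvingsS; case: eqP => _; last by rewrite addn0.
by rewrite addn1 exprSr invfM mulrA.
Qed.

Lemma box_volume_gt0 b : 0 < box_volume b.
Proof. by apply: prodr_gt0 => i _; exact: side_gt0. Qed.

Lemma box_volume_child j b : box_volume (child j b) = box_volume b / 2.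
Proof.
rewrite /box_volume (bigD1 (split_dir n b.1))//= [in RHS](bigD1 (split_dir n b.1))//=.
rewrite sideS eqxx mulrAC; congr (_ * _ / _).
by apply: eq_bigr => i /negbTE ni; rewrite sideS ni.
Qed.

Lemma measurable_pbox b : measurable (pbox b).
Proof.
exact: (measurable_rV_box (A := fun i => `[b.2 i, b.2 i + side b.1 i[%classic)).
Qed.

Lemma lebesgue_pbox b : mu (pbox b) = (box_volume b)%:E.
Proof.
rewrite (lebesgue_rV_box (A := fun i => `[b.2 i, b.2 i + side b.1 i[%classic))//.
rewrite /box_volume -prodEFin; apply: eq_bigr => i _.
rewrite lebesgue_measure_itv/= lte_fin ltrDl side_gt0.
by rewrite -EFinB addrAC subrr add0r.
Qed.

Lemma pbox_child b : pbox b = pbox (child false b) `|` pbox (child true b).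
Proof.
set d := split_dir n b.1; apply/seteqP; split => x /=.
  move=> xb; have [xd|xd] := ltP (x ord0 d) (b.2 d + side b.1.+1 d); [left|right] => i;
      have := xb i; rewrite /= !in_itv/=.
  - rewrite addr0; case: (i =P d) => [->|/eqP/negbTE nid]; last by rewrite sideS nid.
    by move=> /andP[->].
  - case: (i =P d) => [->|/eqP/negbTE nid]; last by rewrite addr0 sideS nid.
    move=> /andP[_ xr]; rewrite xd/= -addrA; apply: (lt_le_trans xr).
    by rewrite sideS eqxx -splitr.
have s0 := side_gt0.
move=> [] xb i; have := xb i; rewrite /= !in_itv/= ?addr0 sideS;
  case: (i =P d) => [->|/eqP/negbTE nid]; rewrite ?eqxx ?nid ?addr0//;
  have := s0 b.1 d => ? /andP[? ?]; apply/andP; split; lra.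
Qed.

Lemma pbox_disj b : [disjoint pbox (child false b) & pbox (child true b)].
Proof.
set d := split_dir n b.1; apply/eqP; rewrite -subset0 => x /= [/(_ d) + /(_ d)].
rewrite /= !in_itv/= eqxx addr0 => /andP[_ +] /andP[+ _]; lra.
Qed.

Local Notation approximable := (approximable mu child pbox).
Local Notation step_on := (step_on child pbox).
Local Notation halfspace i c := [set x : V | x ord0 i < c].

Lemma measurable_halfspace i c : measurable (halfspace i c).
Proof.
rewrite (_ : mkset _ = (fun x : V => x ord0 i) @^-1` `]-oo, c[%classic).
  by rewrite -[X in measurable X]setTI; exact: measurable_rV_coord.
by apply/seteqP; split => x; rewrite /= in_itv.
Qed.

Let int_self (b : box_index) (f : V -> R) :
  (\int[mu]_(x in pbox b) `|f x - f x|%:E = 0)%E.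
Proof. by under eq_integral do rewrite subrr normr0; rewrite integral0. Qed.

(** A box that does not meet the hyperplane is either inside or outside of the
    halfspace. If it meets the hyperplane, then only one of its halves does when it
    is cut across the coordinate [i]: each such cut halves the undecided volume. *)
Lemma halfspace_step i c m (b : box_index) : exists h : V -> R,
  [/\ measurable_fun setT h, step_on m b h &
   (\int[mu]_(x in pbox b) `|\1_(halfspace i c) x - h x|%:E
     <= (box_volume b * (side (b.1 + m) i / side b.1 i))%:E)%E].
Proof.
have mH : measurable_fun setT (\1_(halfspace i c) : V -> R).
  by apply: measurable_indic; exact: measurable_halfspace.
have side_case k (d : box_index) : d.2 i + side d.1 i <= c \/ c <= d.2 i ->
    step_on k d (\1_(halfspace i c) : V -> R).
  move=> hd; apply: (step_on_leq pbox_child (leq0n k)) => /=.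
  case: hd => hd; [exists 1|exists 0] => x /(_ i) /=; rewrite in_itv/= indicE => /andP[xl xr].
    by rewrite mem_set//=; exact: lt_le_trans hd.
  by rewrite memNset//=; apply/negP; rewrite -leNgt (le_trans hd).
elim: m b => [|m IH] b.
  exists (cst 0); split => //; first by exists 0.
  rewrite addn0 mulfV ?gt_eqF ?side_gt0// mulr1.
  apply: (@le_trans _ _ (\int[mu]_(x in pbox b) cst 1 x)%E).
    apply: le_nonneg_integral => x _; rewrite lee_fin//= subr0 indicE.
    by case: (_ \in _); rewrite ?normr1 ?normr0.
  by rewrite integral_cst ?mul1e ?lebesgue_pbox//; exact: measurable_pbox.
(* approximations on the two children glue to one on the box *)
have glue (h0 h1 : V -> R) e0 e1 :
    measurable_fun setT h0 -> step_on m (child false b) h0 ->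
    (\int[mu]_(x in pbox (child false b)) `|\1_(halfspace i c) x - h0 x|%:E <= e0%:E)%E ->
    measurable_fun setT h1 -> step_on m (child true b) h1 ->
    (\int[mu]_(x in pbox (child true b)) `|\1_(halfspace i c) x - h1 x|%:E <= e1%:E)%E ->
    exists h : V -> R, [/\ measurable_fun setT h, step_on m.+1 b h &
   (\int[mu]_(x in pbox b) `|\1_(halfspace i c) x - h x|%:E <= (e0 + e1)%:E)%E].
  move=> mh0 s0 h0e mh1 s1 h1e.
  pose h x := \1_(pbox (child false b)) x * h0 x + \1_(pbox (child true b)) x * h1 x.
  have mi j : measurable_fun setT (\1_(pbox (child j b)) : V -> R).
    by apply: measurable_indic; exact: measurable_pbox.
  have mh : measurable_fun setT h.
    by apply: measurable_funD; apply: measurable_funM.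
  have disj x : pbox (child false b) x -> ~ pbox (child true b) x.
    by move=> xb xb'; have /eqP/seteqP[+ _] := pbox_disj b; move=> /(_ x); apply.
  have hh0 x : pbox (child false b) x -> h0 x = h x.
    move=> xb; rewrite /h !indicE mem_set// memNset ?mul1r ?mul0r ?addr0//.
    exact: disj.
  have hh1 x : pbox (child true b) x -> h1 x = h x.
    move=> xb; rewrite /h !indicE (mem_set xb) memNset ?mul1r ?mul0r ?add0r//.
    by move=> /disj.
  exists h; split => //.
    split; first exact: (eq_step_on pbox_child hh0).
    exact: (eq_step_on pbox_child hh1).
  rewrite (integral_children mu measurable_pbox pbox_child pbox_disj b
    (f := fun x => `|\1_(halfspace i c) x - h x|))//; last first.
    by apply: measurableT_comp => //; exact: measurable_funB.
  rewrite EFinD; apply: leeD.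
    by apply: le_trans h0e; apply: le_nonneg_integral => x xb; rewrite ?hh0.
  by apply: le_trans h1e; apply: le_nonneg_integral => x xb; rewrite ?hh1.
have [h0 [mh0 s0 h0e]] := IH (child false b).
have [h1 [mh1 s1 h1e]] := IH (child true b).
have sd := side_gt0 b.1 i.
rewrite addnS -addSn.
case: (i =P split_dir n b.1) => [ie|/eqP/negbTE ie]; last first.
  have [h [mh sh he]] := glue _ _ _ _ mh0 s0 h0e mh1 s1 h1e.
  exists h; split => //; apply: (le_trans he); rewrite lee_fin !box_volume_child/=.
  by rewrite -mulrDl -splitr sideS ie.
have half : side b.1.+1 i = side b.1 i / 2 by rewrite sideS -ie eqxx.
have [cl|cl] := leP c (b.2 i + side b.1.+1 i).
  have st : step_on m (child true b) (\1_(halfspace i c) : V -> R).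
    by apply: (side_case m); right; rewrite /= -ie eqxx.
  have := glue _ _ _ 0 mh0 s0 h0e mH st; rewrite int_self => /(_ (lexx _)) [h [mh sh he]].
  exists h; split => //; apply: (le_trans he); rewrite lee_fin addr0 box_volume_child/= half.
  by rewrite le_eqVlt; apply/orP; left; apply/eqP; field; rewrite gt_eqF.
have st : step_on m (child false b) (\1_(halfspace i c) : V -> R).
  by apply: (side_case m); left; rewrite /= addr0 ltW.
have := glue _ _ 0 _ mH st; rewrite int_self => /(_ _ _ (lexx _) mh1 s1 h1e) [h [mh sh he]].
exists h; split => //; apply: (le_trans he); rewrite lee_fin add0r box_volume_child/= half.
by rewrite le_eqVlt; apply/orP; left; apply/eqP; field; rewrite gt_eqF.
Qed.

Lemma halvings_ge k (i : 'I_n.+1) : (k %/ n.+2 <= halvings k i)%N.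
Proof.
have [->|it] := eqVneq i time; last by have /andP[] := halvings_space k it.
by have /andP[+ _] := @halvings_time n k; apply: leq_trans; rewrite -addnn leq_addr.
Qed.

Lemma approximable_halfspace b i c : approximable b (\1_(halfspace i c) : V -> R).
Proof.
move=> e e0; pose K := box_volume b * 2 ^+ halvings b.1 i / e.
have K0 : 0 <= K by rewrite divr_ge0 ?(ltW e0)// mulr_ge0 ?exprn_ge0//; exact/ltW/box_volume_gt0.
pose j := Num.Def.archi_bound K.
have Kj : K < 2 ^+ j.
  apply: (lt_trans (archi_boundP K0)).
  by rewrite -natrX ltr_nat ltn_expl.
have [h [mh sh he]] := halfspace_step i c (j * n.+2) b.
exists (j * n.+2)%N, h; split => //; apply: (le_trans he); rewrite lee_fin.
have -> : side (b.1 + j * n.+2) i / side b.1 i =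
    2 ^+ halvings b.1 i / 2 ^+ halvings (b.1 + j * n.+2) i.
  rewrite /side; have r0 := pradius_gt0 i s_gt0; field.
  by rewrite !gt_eqF ?exprn_gt0.
rewrite mulrA ler_pdivrMr ?exprn_gt0// -ler_pdivrMl// mulrC.
apply: (le_trans (ltW Kj)); rewrite ler_weXn2l ?ler1n//.
apply: leq_trans (halvings_ge _ i).
by rewrite divnDr ?dvdn_mull// mulnK// leq_addl.
Qed.

(** The halfspaces generate the Borel sets. *)
Lemma approximable_pbox b A : measurable A -> approximable b (\1_A : V -> R).
Proof.
move=> mA; suff : [set A | measurable A /\ approximable b (\1_A : V -> R)] A by case.
have sG := @sigma_algebra_approximable _ _ _ mu _ child pbox
  box_volume measurable_pbox pbox_child lebesgue_pbox b.
have [G0 GC GU] := sG.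
move: A mA; apply: smallest_sub => // A.
rewrite -bigcup_seq/= => -[i _ [B mB <-]]; rewrite setTI.
have {}mB : (@RGenInftyO.G R).-sigma.-measurable B.
  by rewrite -RGenInftyO.measurableE; exact: mB.
move: B mB.
apply: smallest_sub; first split => /=.
- by rewrite preimage_set0.
- by move=> B; rewrite !setTD preimage_setC -setTD => /GC.
- by move=> F GF; rewrite preimage_bigcup; exact: GU.
move=> _ [c ->] /=.
rewrite (_ : _ @^-1` _ = halfspace i c).
  by split; [exact: measurable_halfspace|exact: approximable_halfspace].
by apply/seteqP; split => x; rewrite /= in_itv.
Qed.

End parabolic_boxes.

(** * The John-Nirenberg inequality for ellipsoids *)

Section john_nirenberg.
Context {R : realType} (n : nat).

Local Notation V := 'rV[R]_n.+1.
Local Notation mu := (@lebesgue_rV R n.+1).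
Local Notation c := (n.+2%:R : R).

Lemma Lp_loc_cylinder p (f : V -> R) x r : Lp_loc p f ->
  (\int[mu]_(y in cylinder x r) (`|f y| `^ p)%:E < +oo)%E.
Proof.
move=> [_ hf]; apply: le_lt_trans (hf _ (@closed_box_compact _ _ x r)).
apply: le_nonneg_integral_set => [y|y yx i]; first by rewrite lee_fin powR_ge0.
by have /andP[/ltW ? /ltW ?] := yx i; rewrite /= in_itv/=; apply/andP.
Qed.

Lemma integrable_cylinder (a : V -> R) x r (D : set V) : Lp_loc 1 a ->
  measurable D -> D `<=` cylinder x r -> mu.-integrable D (EFin \o a).
Proof.
move=> la mD Dx; have ma := la.1.
apply: (integrableS (measurable_cylinder x r)) => //.
apply/integrableP; split; first by apply/measurable_EFinP; exact: measurable_funTS.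
apply: le_lt_trans (Lp_loc_cylinder x r la).
by apply: le_nonneg_integral => y _; rewrite ?abse_ge0// powRr1.
Qed.

Lemma subset_ellipsoid (x : V) r t : 0 < r -> r <= t -> ellipsoid x r `<=` ellipsoid x t.
Proof.
move=> r0 rt y; rewrite /ellipsoid/=; apply: le_lt_trans.
have t0 : 0 < t by exact: lt_le_trans rt.
apply: lerD; rewrite ler_wpM2l ?sqnorm_ge0 ?sqr_ge0// lef_pV2 ?posrE ?exprn_gt0//.
  by rewrite lerXn2r// nnegrE ltW.
by rewrite lerXn2r// nnegrE ltW.
Qed.

Lemma bmo_norm_ge0 (a : V -> R) : (0 <= bmo_norm a)%E.
Proof.
apply: le_ereal_sup_tmp; exists (mean_osc a (ellipsoid 0 1)).
  by exists (0, 1) => //=; exact: ltr01.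
rewrite /mean_osc mule_ge0 ?lee_fin ?invr_ge0 ?fine_ge0//.
by apply: integral_ge0 => y _; rewrite lee_fin.
Qed.

(** The norm enters through a positive upper bound [M], so that powers of [M] can be
    divided by; the case of norm zero is recovered in the limit. *)
Variable a : V -> R.
Hypothesis a_bmo : BMO a.
Variable M : R.
Hypothesis M_gt0 : 0 < M.
Hypothesis a_le : (bmo_norm a <= M%:E)%E.

Let ma : measurable_fun setT a. Proof. by have [[]] := a_bmo. Qed.

Lemma integrable_ellipsoid x r : 0 < r -> mu.-integrable (ellipsoid x r) (EFin \o a).
Proof.
move=> r0; apply: (integrable_cylinder (x := x) (r := r) a_bmo.1).
  exact: measurable_ellipsoid.
exact: ellipsoid_cylinder.
Qed.

Let mdist z : measurable_fun setT (fun y => `|a y - z|).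
Proof. by apply: measurableT_comp => //; exact: measurable_funB. Qed.

Lemma mean_osc_le x r : 0 < r ->
  (\int[mu]_(y in ellipsoid x r) `|a y - mean a (ellipsoid x r)|%:E <= (M * vol x r)%:E)%E.
Proof.
move=> r0; have v0 := vol_gt0 x r0.
have : (mean_osc a (ellipsoid x r) <= M%:E)%E.
  by apply: le_trans a_le; apply: ereal_sup_ubound; exists (x, r).
rewrite /mean_osc -/(vol x r) => h.
by move: h; rewrite lee_pdivrMl// mulrC EFinM.
Qed.

Lemma mean_dist_le x r z : 0 < r ->
  ((vol x r * `|mean a (ellipsoid x r) - z|)%:E <=
   \int[mu]_(y in ellipsoid x r) `|a y - z|%:E)%E.
Proof.
move=> r0; have v0 := vol_gt0 x r0.
have mE := measurable_ellipsoid x r.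
have iz : mu.-integrable (ellipsoid x r) (EFin \o cst z).
  by apply: integrable_cst_fin => //; rewrite volE// ltry.
have ia := integrable_ellipsoid x r0.
rewrite -[X in (X * _)%R]gtr0_norm// -normrM mulrBr /mean -/(vol x r).
rewrite mulrA mulfV ?gt_eqF// mul1r.
rewrite (_ : vol x r * z = \int[mu]_(y in ellipsoid x r) (cst z y)); last first.
  by rewrite Rintegral_cst// mulrC.
rewrite -RintegralB//.
have iaz : mu.-integrable (ellipsoid x r) (EFin \o (fun y => a y - z)).
  by rewrite /comp; under eq_fun do rewrite EFinB; exact: integrableB.
have := le_normr_Rintegral mE iaz; rewrite -lee_fin => /le_trans; apply.
rewrite /Rintegral fineK//; apply: integrable_fin_num => //.
exact: (integrable_norm iaz).
Qed.

Definition doubling_const : R := (2 * c) ^+ n.+2.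

(** Passing from an ellipsoid to its double costs a bounded multiple of the norm, so
    that the means over dyadic dilates grow at most linearly in the exponent. This is
    the source of the logarithm in the condition on [phi]. *)
Lemma mean_double_dist x r : 0 < r ->
  `|mean a (ellipsoid x (2 * r)) - mean a (ellipsoid x r)| <= doubling_const * M.
Proof.
move=> r0; have r20 : 0 < 2 * r by rewrite mulr_gt0.
have v0 := vol_gt0 x r0; rewrite distrC -(ler_pM2l v0) -lee_fin.
apply: (le_trans (mean_dist_le x _ r0)).
apply: (@le_trans _ _ (M * vol x (2 * r))%:E).
  apply: le_trans (mean_osc_le x r20).
  by apply: le_nonneg_integral_set => //; apply: subset_ellipsoid => //; lra.
rewrite lee_fin [leRHS]mulrC [doubling_const * M]mulrC -mulrA ler_pM2l//.
apply: (le_trans (vol_le x r20)).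
apply: (@le_trans _ _ (doubling_const * (2 ^+ n.+1 * (r / c) ^+ n.+2))).
  rewrite /doubling_const [leRHS]mulrCA -[X in _ <= _ * X]exprMn.
  have -> : 2 * c * (r / c) = 2 * r by rewrite mulrACA -mulrA mulrCA mulfV ?mulr1// mulrC.
  exact: lexx.
by rewrite ler_pM2l ?vol_ge// exprn_gt0// mulr_gt0.
Qed.

Definition box_osc_const : R := 4 ^+ n.+1 * c ^+ n.+2.

Lemma box_osc_const_gt0 : 0 < box_osc_const.
Proof. by rewrite /box_osc_const mulr_gt0// exprn_gt0. Qed.

(** A box of generation [b.1] has sides comparable to [rho] in space and [rho ^ 2] in
    time, hence lies in an ellipsoid of comparable volume. *)
Lemma pbox_osc s (b : nat * ('I_n.+1 -> R)) : 0 < s ->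
  exists z, (\int[mu]_(y in pbox s b) `|a y - z|%:E <= (box_osc_const * M * box_volume s b)%:E)%E.
Proof.
move=> s0; pose rho := s / 2 ^+ (b.1 %/ n.+2).
have rho0 : 0 < rho by rewrite divr_gt0// exprn_gt0.
have crho : 0 < c * rho by rewrite mulr_gt0.
pose x : V := \row_i b.2 i.
have side_le (i : 'I_n.+1) : side s b.1 i <= pradius rho i.
  rewrite /side /pradius; case: eqP => [->|/eqP it].
    rewrite /rho expr_div_n -exprM ler_pM2l ?exprn_gt0// lef_pV2 ?posrE ?exprn_gt0//.
    rewrite ler_weXn2l ?ler1n// muln2.
    by have /andP[? ?] := @halvings_time n b.1.
  rewrite ler_pM2l// lef_pV2 ?posrE ?exprn_gt0// ler_weXn2l ?ler1n//.
  by have /andP[? ?] := halvings_space b.1 it.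
have side_ge (i : 'I_n.+1) : pradius rho i / 2 <= side s b.1 i.
  rewrite /side /pradius; case: eqP => [->|/eqP it].
    rewrite /rho expr_div_n -exprM -mulrA ler_pM2l ?exprn_gt0//.
    rewrite -invfM -exprSr lef_pV2 ?posrE ?exprn_gt0// ler_weXn2l ?ler1n// muln2.
    by have /andP[? ?] := @halvings_time n b.1.
  rewrite -mulrA -invfM -exprSr ler_pM2l// lef_pV2 ?posrE ?exprn_gt0// ler_weXn2l ?ler1n//.
  by have /andP[? ?] := halvings_space b.1 it.
have sub : pbox s b `<=` ellipsoid x (c * rho).
  apply: (subset_trans _ (cylinder_ellipsoid (x := x) rho0)) => y yb i.
  have := yb i; rewrite /= in_itv/= mxE => /andP[h1 h2].
  have := side_le i; have := pradius_gt0 i rho0; lra.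
exists (mean a (ellipsoid x (c * rho))).
apply: (@le_trans _ _ (M * vol x (c * rho))%:E).
  apply: le_trans (mean_osc_le x crho).
  exact: le_nonneg_integral_set.
rewrite lee_fin [box_osc_const * M]mulrC -mulrA ler_pM2l//.
apply: (le_trans (vol_le x crho)).
have wge : rho ^+ n.+2 / 2 ^+ n.+1 <= box_volume s b.
  rewrite -prod_pradius /box_volume -[X in _ / 2 ^+ X](card_ord n.+1) -prodr_const -prodf_div.
  apply: ler_prod => i _; rewrite side_ge andbT.
  by rewrite divr_ge0// ltW// pradius_gt0.
apply: le_trans (ler_wpM2l _ wge); last by rewrite mulr_ge0 ?exprn_ge0.
have e4 : 4 ^+ n.+1 = 2 ^+ n.+1 * 2 ^+ n.+1 :> R.
  by rewrite -exprMn; congr (_ ^+ _); ring.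
rewrite /box_osc_const [X in _ * X]exprMn e4.
by rewrite le_eqVlt; apply/orP; left; apply/eqP; field; rewrite gt_eqF// exprn_gt0.
Qed.

Lemma pbox_john_nirenberg q s (b : nat * ('I_n.+1 -> R)) : 1 <= q -> 0 < s ->
  (\int[mu]_(y in pbox s b) (`|a y - mean a (pbox s b)| `^ q)%:E <=
   (2 `^ q * (tree_const q * (2 * box_osc_const) `^ q) * M `^ q * box_volume s b)%:E)%E.
Proof.
move=> q1 s0; have K0 : 0 < box_osc_const * M.
  by rewrite mulr_gt0// box_osc_const_gt0.
have ia d : mu.-integrable (pbox s d) (EFin \o a).
  pose x : V := \row_i d.2 i.
  have [z _] := pbox_osc d s0.
  apply: (integrable_cylinder (x := x) (r := s) a_bmo.1); first exact: measurable_pbox.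
  move=> y yd i; have := yd i; rewrite /= in_itv/= mxE => /andP[h1 h2].
  have := pradius_gt0 i s0; suff : side s d.1 i <= pradius s i by lra.
  by rewrite ler_pdivrMr ?exprn_gt0// ler_peMr ?exprn_ege1 ?ler1n// ltW// pradius_gt0.
have := @dyadic_john_nirenberg _ _ _ mu _ (child s) (pbox s) (box_volume s)
  (measurable_pbox s) (pbox_child s0) (pbox_disj s) (lebesgue_pbox s0)
  (box_volume_gt0 s0) (box_volume_child s)
  (fun b A mA => approximable_pbox s0 b mA) a ma ia _ q K0 q1 (fun b => pbox_osc b s0) b.
rewrite /mean lebesgue_pbox//= => /le_trans; apply; rewrite lee_fin.
rewrite le_eqVlt; apply/orP; left; apply/eqP; congr (_ * _).
move: box_osc_const box_osc_const_gt0 => B B0.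
by rewrite [2 * (B * M)]mulrA (powRM q (x := 2 * B))// ?ltW// ?mulr_gt0//; ring.
Qed.

Definition jn_box_const (q : R) : R :=
  2 `^ q * (tree_const q * (2 * box_osc_const) `^ q) * 2 ^+ n.+2.

Definition jn_shift_const : R := jn_box_const 1 * c ^+ n.+2 / 2 ^+ n.+1.

Definition jn_const (q : R) : R :=
  2 `^ q * (jn_box_const q + jn_shift_const `^ q * 2 ^+ n.+1).

Lemma tree_const_ge0 q : 0 <= tree_const q :> R.
Proof. by rewrite addr_ge0 ?mulr_ge0 ?powR_ge0. Qed.

Lemma jn_box_const_ge0 q : 0 <= jn_box_const q.
Proof.
rewrite /jn_box_const; apply: mulr_ge0; last exact: exprn_ge0.
by apply: mulr_ge0; rewrite ?powR_ge0// mulr_ge0 ?powR_ge0 ?tree_const_ge0.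
Qed.

Lemma jn_shift_const_ge0 : 0 <= jn_shift_const.
Proof. by apply: divr_ge0; rewrite ?exprn_ge0// mulr_ge0 ?jn_box_const_ge0 ?exprn_ge0. Qed.

Lemma jn_const_ge0 q : 0 <= jn_const q.
Proof.
apply: mulr_ge0; first exact: powR_ge0.
by apply: addr_ge0; rewrite ?jn_box_const_ge0// mulr_ge0 ?powR_ge0 ?exprn_ge0.
Qed.

(** The ellipsoid is put into a root box [b] of comparable volume, and the mean [z] over
    [b] is replaced by the mean over the ellipsoid; the case of exponent 1 bounds the
    difference of the two. *)
Lemma john_nirenberg q x r : 1 <= q -> 0 < r ->
  (\int[mu]_(y in ellipsoid x r) (`|a y - mean a (ellipsoid x r)| `^ q)%:E <=
   (jn_const q * M `^ q * r ^+ n.+2)%:E)%E.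
Proof.
move=> q1 r0; have r20 : 0 < 2 * r by rewrite mulr_gt0.
have q0 : 0 <= q by exact: le_trans q1.
pose b : nat * ('I_n.+1 -> R) := (0%N, fun i => x ord0 i - pradius r i).
pose z := mean a (pbox (2 * r) b).
have sub : ellipsoid x r `<=` pbox (2 * r) b.
  apply: subset_trans (ellipsoid_cylinder r0) _ => y yx i.
  have /andP[h1 h2] := yx i; rewrite /= in_itv/= (ltW h1)/=; apply: (lt_le_trans h2).
  rewrite /side /halvings /= !div0n divn_small// divn_small; last first.
    by rewrite add0n ltnS leq_subr.
  rewrite if_same expr0 divr1 -addrA lerD2l /pradius.
  by case: ifP => _; rewrite ?exprMn; have : 0 < r ^+ 2 by [rewrite exprn_gt0|]; nra.
have wE : box_volume (2 * r) b = 2 ^+ n.+2 * r ^+ n.+2.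
  rewrite -exprMn -prod_pradius; apply: eq_bigr => i _.
  rewrite /side /halvings /= !div0n divn_small// divn_small ?if_same ?expr0 ?divr1//.
  by rewrite add0n ltnS leq_subr.
have md q' z' : measurable_fun setT (fun y => `|a y - z'| `^ q').
  by apply: (measurableT_comp (measurable_powR q')).
have box_jn q' : 1 <= q' ->
    (\int[mu]_(y in ellipsoid x r) (`|a y - z| `^ q')%:E <=
      (jn_box_const q' * M `^ q' * r ^+ n.+2)%:E)%E.
  move=> q'1; apply: le_trans (_ : (_ <= \int[mu]_(y in pbox (2 * r) b) (`|a y - z| `^ q')%:E)%E) _.
    by apply: le_nonneg_integral_set => // y; rewrite lee_fin powR_ge0.
  apply: le_trans (pbox_john_nirenberg b q'1 r20) _; rewrite lee_fin wE.
  by rewrite /jn_box_const le_eqVlt; apply/orP; left; apply/eqP; ring.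
have v0 := vol_gt0 x r0.
have shift : `|z - mean a (ellipsoid x r)| <= jn_shift_const * M.
  have : vol x r * `|z - mean a (ellipsoid x r)| <= jn_box_const 1 * M * r ^+ n.+2.
    rewrite -lee_fin distrC; apply: (le_trans (mean_dist_le x z r0)).
    have := box_jn 1 (lexx _); rewrite (powRr1 (ltW M_gt0)); apply: le_trans.
    by apply: le_nonneg_integral => y _; rewrite ?lee_fin// powRr1.
  move=> h; rewrite -(ler_pM2l v0); apply: (le_trans h).
  have -> : jn_box_const 1 * M * r ^+ n.+2 =
      jn_shift_const * M * (2 ^+ n.+1 * (r / c) ^+ n.+2).
    rewrite /jn_shift_const expr_div_n; field.
    by rewrite !expf_neq0// pnatr_eq0.
  rewrite [leRHS]mulrC ler_wpM2l ?vol_ge// mulr_ge0 ?jn_shift_const_ge0//.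
  exact: ltW.
apply: (@le_trans _ _ (\int[mu]_(y in ellipsoid x r) (2 `^ q * (`|a y - z| `^ q))%:E +
   \int[mu]_(y in ellipsoid x r) (cst (2 `^ q * (jn_shift_const * M) `^ q) y)%:E)%E).
  apply: le_integralD => //.
  - exact: measurable_ellipsoid.
  - by apply: measurable_funTS; exact: measurable_funM.
  - by move=> y _; rewrite mulr_ge0 ?powR_ge0.
  move=> y _ /=; rewrite -mulrDr.
  apply: (@le_trans _ _ ((`|a y - z| + `|z - mean a (ellipsoid x r)|) `^ q)).
    apply: powR_le => //; have := ler_normD (a y - z) (z - mean a (ellipsoid x r)).
    by rewrite addrA subrK.
  apply: (le_trans (powRD_le q0 (normr_ge0 _) (normr_ge0 _))).
  by rewrite ler_pM2l ?powR_gt0// lerD2l; apply: powR_le.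
rewrite (integral_cst mu (measurable_ellipsoid x r) (2 `^ q * (jn_shift_const * M) `^ q)%:E) volE//.
rewrite integralZ_EFin ?powR_ge0//; last 2 first.
- exact: measurable_ellipsoid.
- exact: measurable_funTS.
apply: (@le_trans _ _ ((2 `^ q)%:E * (jn_box_const q * M `^ q * r ^+ n.+2)%:E +
  (2 `^ q * (jn_shift_const * M) `^ q)%:E * (2 ^+ n.+1 * r ^+ n.+2)%:E)%E).
  apply: leeD; apply: lee_wpmul2l.
  - by rewrite lee_fin powR_ge0.
  - exact: box_jn.
  - by rewrite lee_fin; apply: mulr_ge0; exact: powR_ge0.
  - by rewrite lee_fin; exact: vol_le.
rewrite -!EFinM -EFinD lee_fin (powRM q jn_shift_const_ge0 (ltW M_gt0)) /jn_const.
by rewrite le_eqVlt; apply/orP; left; apply/eqP; ring.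
Qed.

End john_nirenberg.

(** * Integral inequalities *)

Lemma hoelder_le d (T : measurableType d) (R : realType)
    (mu : {measure set T -> \bar R}) (D : set T) (u v : T -> R) (p q A B : R) :
  measurable D -> measurable_fun setT u -> measurable_fun setT v ->
  0 < p -> 0 < q -> p^-1 + q^-1 = 1 -> 0 <= A -> 0 <= B ->
  (\int[mu]_(x in D) (`|u x| `^ p)%:E <= (A `^ p)%:E)%E ->
  (\int[mu]_(x in D) (`|v x| `^ q)%:E <= (B `^ q)%:E)%E ->
  (\int[mu]_(x in D) (`|u x| * `|v x|)%:E <= (A * B)%:E)%E.
Proof.
move=> mD mu_ mv p0 q0 pq A0 B0 uA vB.
pose restr (w : T -> R) x := w x * \1_D x.
have mr w : measurable_fun setT w -> measurable_fun setT (restr w).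
  by move=> mw; apply: measurable_funM => //; exact: measurable_indic.
have := @hoelder _ _ _ mu _ _ p q (mr u mu_) (mr v mv) p0 q0 pq.
rewrite Lnorm1.
have -> : (\int[mu]_x `|(EFin \o (restr u \* restr v)%R) x| =
   \int[mu]_(x in D) (`|u x| * `|v x|)%:E)%E.
  rewrite [RHS]integral_mkcond; apply: eq_integral => x _.
  rewrite patchE /restr /= indicE; case: ifPn => xD /=.
    by rewrite !mulr1 normrM.
  by rewrite !mulr0 normr0.
have normE t w K : 0 < t -> 0 <= K ->
    (\int[mu]_(x in D) (`|w x| `^ t)%:E <= (K `^ t)%:E)%E ->
    ('N[mu]_t%:E[EFin \o restr w] <= K%:E)%E.
  move=> t0 K0 wK; rewrite unlock.
  have -> : (\int[mu]_x (`|(EFin \o restr w) x| `^ t) =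
      \int[mu]_(x in D) (`|w x| `^ t)%:E)%E.
    rewrite [RHS]integral_mkcond; apply: eq_integral => x _.
    rewrite patchE /restr /= indicE; case: ifPn => xD /=.
      by rewrite mulr1.
    by rewrite mulr0 normr0 powR0// gt_eqF.
  have i0 : (0 <= \int[mu]_(x in D) (`|w x| `^ t)%:E)%E.
    by apply: integral_ge0 => x _; rewrite lee_fin powR_ge0.
  have : ((\int[mu]_(x in D) (`|w x| `^ t)%:E) `^ t^-1 <= ((K `^ t)%:E) `^ t^-1)%E.
    apply: gt0_ler_poweR; rewrite ?invr_ge0 ?(ltW t0)//.
      by rewrite in_itv/= i0 leey.
    by rewrite in_itv/= lee_fin powR_ge0 leey.
  by move=> /le_trans; apply; rewrite poweR_EFin powRK// gt_eqF.
move=> /le_trans; apply; rewrite EFinM.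
by apply: lee_pmul; rewrite ?Lnorm_ge0//; apply: normE.
Qed.

(** The lower sum of a step function below [h]; the intervals are disjoint, hence at
    most one step is active at each point. *)
Lemma ge0_step_integral (R : realType) (h : R -> \bar R) (r : R) (c s : nat -> R) (J : nat) :
  r <= s 0%N -> (forall j, s j <= s j.+1) -> (forall j, 0 <= c j) ->
  (forall t, r < t -> (0 <= h t)%E) ->
  (forall j t, s j < t <= s j.+1 -> ((c j)%:E <= h t)%E) ->
  ((\sum_(j < J) c j * (s j.+1 - s j))%:E <=
    \int[@lebesgue_measure R]_(t in `]r, +oo[) h t)%E.
Proof.
move=> rs s_nd c0 h0 ch.
have s_ge j : r <= s j by elim: j => // j IH; exact: le_trans (s_nd j).
pose I j : set R := `]s j, s j.+1]%classic.
pose g J t : R := \sum_(j < J) c j * \1_(I j) t.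
have gh t : r < t -> ((g J t)%:E <= h t)%E /\ (s J < t -> g J t = 0).
  move=> rt; rewrite /g; elim: J => [|k [IH1 IH2]].
    by rewrite big_ord0; split => //; exact: h0.
  rewrite big_ord_recr/=; have [tk|tk] := leP t (s k).
    rewrite indicE memNset ?mulr0 ?addr0; last first.
      by rewrite /I/= in_itv/= ltNge tk.
    by split => // /lt_le_trans/(_ tk); rewrite ltNge s_nd.
  rewrite IH2// add0r indicE.
  have [tk'|tk'] := leP t (s k.+1).
    rewrite mem_set ?mulr1; last by rewrite /I/= in_itv/= tk.
    by split => //; rewrite ?ch ?tk//.
  rewrite memNset ?mulr0; last by rewrite /I/= in_itv/= leNgt tk' andbF.
  by split => //; exact: h0.
apply: (@le_trans _ _ (\int[@lebesgue_measure R]_(t in `]r, +oo[) (g J t)%:E)%E).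
  rewrite /g; under eq_integral do rewrite -sumEFin.
  rewrite ge0_integral_sum//=; last 2 first.
  - by move=> j; apply/measurable_EFinP; apply: measurable_funTS; apply: measurable_funM => //;
      apply: measurable_indic; exact: measurable_itv.
  - by move=> j t _; rewrite lee_fin mulr_ge0.
  rewrite -sumEFin; apply: lee_sum => j _.
  have mI : measurable (I j) by exact: measurable_itv.
  rewrite integralZ_EFin//.
  rewrite integral_indic//.
  rewrite (_ : I j `&` _ = I j); last first.
    apply/setIidPl => t; rewrite /I/= !in_itv/= andbT => /andP[+ _].
    exact: le_lt_trans.
  rewrite -[X in (_ <= _ * X)%E]/(lebesgue_measure (I j)) /I.
  rewrite lebesgue_measure_itv/= lte_fin EFinM; case: ltP => // ss.
  rewrite (_ : _ - _ = 0) ?mule0//; apply/eqP; rewrite subr_eq0 eq_le s_nd ss//.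
apply: le_nonneg_integral => t; rewrite /= in_itv/= andbT => rt.
  by rewrite lee_fin sumr_ge0// => j _; rewrite mulr_ge0.
by have [] := gh t rt.
Qed.

(** * Growth of the local norms *)

Section morrey_growth.
Context {R : realType} (n : nat).

Local Notation V := 'rV[R]_n.+1.
Local Notation mu := (@lebesgue_rV R n.+1).
Variable p : R.
Hypothesis p_gt1 : 1 < p.
Local Notation Qp := (n.+2%:R / p : R).

Let p_gt0 : 0 < p. Proof. exact: lt_trans p_gt1. Qed.
Let p_neq0 : p != 0. Proof. by rewrite gt_eqF. Qed.

Definition local_norm (f : V -> R) (x : V) (s : R) : R :=
  fine (\int[mu]_(y in ellipsoid x s) (`|f y| `^ p)%:E) `^ p^-1.

Lemma local_norm_ge0 f x s : 0 <= local_norm f x s.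
Proof. exact: powR_ge0. Qed.

Lemma measurable_norm_powR (f : V -> R) D :
  measurable_fun setT f -> measurable_fun D (fun y => `|f y| `^ p).
Proof.
move=> mf; apply: measurable_funTS.
by apply: (measurableT_comp (measurable_powR p)); exact: measurableT_comp.
Qed.

Lemma integral_norm_powR_fin (f : V -> R) x s : Lp_loc p f -> 0 < s ->
  (\int[mu]_(y in ellipsoid x s) (`|f y| `^ p)%:E < +oo)%E.
Proof.
move=> lf s0; apply: le_lt_trans (Lp_loc_cylinder x s lf).
apply: le_nonneg_integral_set => [y|]; first by rewrite lee_fin powR_ge0.
exact: ellipsoid_cylinder.
Qed.

Lemma local_normE f x s : Lp_loc p f -> 0 < s ->
  (\int[mu]_(y in ellipsoid x s) (`|f y| `^ p)%:E = (local_norm f x s `^ p)%:E)%E.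
Proof.
move=> lf s0.
have i0 : (0 <= \int[mu]_(y in ellipsoid x s) (`|f y| `^ p)%:E)%E.
  by apply: integral_ge0 => y _; rewrite lee_fin powR_ge0.
rewrite /local_norm powRVK ?fine_ge0// fineK// ge0_fin_numE//.
exact: integral_norm_powR_fin.
Qed.

Lemma local_norm_le f x s t : Lp_loc p f -> 0 < s -> s <= t ->
  local_norm f x s <= local_norm f x t.
Proof.
move=> lf s0 st; have t0 : 0 < t by exact: lt_le_trans st.
apply: powR_le; rewrite ?invr_ge0 ?(ltW p_gt0)//.
  by apply: fine_ge0; apply: integral_ge0 => y _; rewrite lee_fin powR_ge0.
apply: fine_le; [by rewrite local_normE|by rewrite local_normE|].
apply: le_nonneg_integral_set => [y|]; first by rewrite lee_fin powR_ge0.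
exact: subset_ellipsoid.
Qed.

Variable phi : V -> R -> R.
Hypothesis phi_gt0 : forall x r, 0 < r -> 0 < phi x r.

Lemma morrey_normE f x s : Lp_loc p f -> 0 < s ->
  ((phi x s)^-1%:E * ((s ^- n.+2)%:E *
     \int[mu]_(y in ellipsoid x s) (`|f y| `^ p)%:E) `^ p^-1 =
   ((phi x s)^-1 * (s `^ (- Qp) * local_norm f x s))%:E)%E.
Proof.
move=> lf s0; rewrite local_normE//.
transitivity ((phi x s)^-1 * (s ^- n.+2 * local_norm f x s `^ p) `^ p^-1)%:E => //.
congr (_ * _)%:E.
rewrite powRM ?powR_ge0 ?invr_ge0 ?exprn_ge0 ?(ltW s0)//.
rewrite powRK ?local_norm_ge0//; congr (_ * _).
by rewrite -powR_invn ?(ltW s0)// -powRrM mulNr.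
Qed.

Variables (f : V -> R) (N : R).
Hypothesis lf : Lp_loc p f.
Hypothesis N_gt0 : 0 < N.
Hypothesis f_le : (morrey_norm p phi f <= N%:E)%E.

Lemma local_norm_morrey x s : 0 < s -> local_norm f x s <= N * (phi x s * s `^ Qp).
Proof.
move=> s0; have : ((phi x s)^-1%:E * ((s ^- n.+2)%:E *
     \int[mu]_(y in ellipsoid x s) (`|f y| `^ p)%:E) `^ p^-1 <= N%:E)%E.
  by apply: le_trans f_le; apply: ereal_sup_ubound; exists (x, s).
rewrite morrey_normE// lee_fin ler_pdivrMl ?phi_gt0//.
rewrite powRN ler_pdivrMl ?powR_gt0// => /le_trans; apply.
by rewrite le_eqVlt; apply/orP; left; apply/eqP; ring.
Qed.

(** The local norm is nondecreasing in the radius, so that its value at [s] is below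
    [N * phi x z * z `^ Qp] for all [z > s] and hence below the infimum of these. *)
Lemma essinf_tail_ge x s : 0 < s -> ((local_norm f x s / N)%:E <= essinf_tail p phi x s)%E.
Proof.
move=> s0; apply/ess_infP.
exists (~` `]s, +oo[%classic); split => //.
- by apply: measurableC; exact: measurable_itv.
- transitivity (lebesgue_measure (~` `]s, +oo[%classic `&` `]s, +oo[%classic)) => //.
  by rewrite setICl measure0.
move=> z /=; apply: contra_not; rewrite in_itv/= andbT => sz.
have z0 : 0 < z by exact: lt_trans sz.
rewrite lee_fin ler_pdivrMr// mulrC; apply: le_trans (local_norm_morrey x z0).
by apply: local_norm_le => //; exact: ltW.
Qed.

Variable C0 : R.
Hypothesis phi_cond : forall x r, 0 < r ->
  (\int[@lebesgue_measure R]_(s in `]r, +oo[)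
     ((1 + ln (s / r))%:E *
      (essinf_tail p phi x s * ((s `^ (Qp + 1))^-1)%:E))
   <= (C0 * phi x r)%:E)%E.

(** The radii start at [4 * r], the distance at which the kernel is tame for points of
    the ellipsoid of radius [r]. *)
Definition dyadic_radius (r : R) (j : nat) : R := 2 ^+ j.+2 * r.

Definition growth_const : R := 2 `^ (Qp + 1) / ln 2.

(** This turns the condition on [phi] into a bound for a weighted series of local
    norms. On the j-th dyadic interval the logarithm is at least a multiple of [j + 3],
    the local norm is at least its value at the left end point, and the power of the
    radius is comparable to its value there. *)
Lemma morrey_growth x r J : 0 < r ->
  \sum_(j < J) j.+3%:R * (dyadic_radius r j `^ (- Qp) * local_norm f x (dyadic_radius r j))
    <= growth_const * C0 * N * phi x r.
Proof.
move=> r0; set s := dyadic_radius r.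
have s0 j : 0 < s j by rewrite mulr_gt0// exprn_gt0.
have sS j : s j.+1 = 2 * s j by rewrite /s /dyadic_radius exprS mulrA.
have rs j : r <= s j by rewrite ler_peMl ?(ltW r0)// exprn_ege1// ler1n.
have ln20 : 0 < ln 2 :> R by rewrite ln_gt0// ltr1n.
have ln21 : ln 2 <= 1 :> R by have := @le_ln1Dx R 1; rewrite -[1 + 1]/(2 : R); apply; lra.
have Qp0 : 0 < Qp + 1 by rewrite addr_gt0// divr_gt0.
pose c j := j.+3%:R * ln 2 * (local_norm f x (s j) / N) / s j.+1 `^ (Qp + 1).
have c0 j : 0 <= c j.
  by rewrite /c !mulr_ge0 ?invr_ge0 ?powR_ge0 ?local_norm_ge0 ?ltW.
have tail0 t : r < t -> (0 <= essinf_tail p phi x t)%E.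
  move=> rt; apply: le_trans (essinf_tail_ge x (lt_trans r0 rt)).
  by rewrite lee_fin divr_ge0 ?local_norm_ge0 ?ltW.
have lnr t : r < t -> 0 <= 1 + ln (t / r).
  by move=> rt; rewrite addr_ge0// ln_ge0// ler_pdivlMr// mul1r ltW.
have h0 t : r < t -> (0 <= (1 + ln (t / r))%:E *
      (essinf_tail p phi x t * ((t `^ (Qp + 1))^-1)%:E))%E.
  by move=> rt; rewrite !mule_ge0 ?tail0// lee_fin ?invr_ge0 ?powR_ge0 ?lnr.
have ch j t : s j < t <= s j.+1 -> ((c j)%:E <= (1 + ln (t / r))%:E *
      (essinf_tail p phi x t * ((t `^ (Qp + 1))^-1)%:E))%E.
  move=> /andP[st ts]; have rt : r < t by exact: le_lt_trans st.
  have t0 : 0 < t by exact: lt_trans rt.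
  rewrite /c -mulrA EFinM [in leRHS]muleC [in leLHS]muleC.
  have hlog : j.+3%:R * ln 2 <= 1 + ln (t / r).
    have : ln (2 ^+ j.+2) <= ln (t / r).
      rewrite ler_ln ?posrE ?exprn_gt0 ?divr_gt0//.
      by rewrite ler_pdivlMr//; exact: ltW.
    rewrite lnXn// => h; rewrite mulr_natl -[j.+3]addn1 mulrnDr mulr1n; lra.
  apply: lee_pmul => //.
  - by rewrite lee_fin !mulr_ge0 ?invr_ge0 ?powR_ge0 ?local_norm_ge0 ?ltW.
  - by rewrite lee_fin mulr_ge0 ?ltW.
  rewrite EFinM; apply: lee_pmul.
  - by rewrite lee_fin divr_ge0 ?local_norm_ge0 ?ltW.
  - by rewrite lee_fin invr_ge0 powR_ge0.
  - apply: le_trans (essinf_tail_ge x t0); rewrite lee_fin ler_pM2r ?invr_gt0//.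
    by apply: local_norm_le => //; exact: ltW.
  - rewrite lee_fin lef_pV2 ?posrE ?powR_gt0//.
    by apply: powR_le; rewrite ?(ltW Qp0)// ltW.
have s_nd j : s j <= s j.+1 by rewrite sS; have := s0 j; lra.
have step : \sum_(j < J) c j * (s j.+1 - s j) <= C0 * phi x r.
  rewrite -lee_fin; apply: le_trans (phi_cond x r0).
  exact: (ge0_step_integral J (rs 0%N) s_nd c0 h0 ch).
rewrite /growth_const -!mulrA.
apply: le_trans (_ : _ <= 2 `^ (Qp + 1) * ((ln 2)^-1 * (N * \sum_(j < J) c j * (s j.+1 - s j)))) _; last first.
  rewrite ler_pM2l ?powR_gt0// ler_pM2l ?invr_gt0// mulrCA ler_pM2l//.
rewrite !mulr_sumr le_eqVlt; apply/orP; left; apply/eqP; apply: eq_bigr => j _.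
have -> : s j.+1 - s j = s j by rewrite sS; ring.
rewrite /c sS powRM ?(ltW (s0 j))//.
have -> : s j `^ (Qp + 1) = s j `^ Qp * s j.
  by rewrite powRD ?powRr1 ?(ltW (s0 j))//; apply/implyP => _; rewrite gt_eqF.
rewrite powRN; field.
by rewrite !gt_eqF ?powR_gt0.
Qed.

End morrey_growth.

(** * Kernel and symbol far from the centre *)

Section far_field.
Context {R : realType} (n : nat).

Local Notation V := 'rV[R]_n.+1.
Local Notation mu := (@lebesgue_rV R n.+1).

Lemma space_partB (x y : V) : space_part (x - y) = space_part x - space_part y.
Proof. by apply/rowP => i; rewrite !mxE. Qed.

Lemma time_partB (x y : V) : time_part (x - y) = time_part x - time_part y.
Proof. by rewrite /time_part !mxE. Qed.

Lemma sqnormD_le m (u v : 'rV[R]_m) : sqnorm (u + v) <= 2 * (sqnorm u + sqnorm v).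
Proof.
rewrite /sqnorm -big_split/= mulr_sumr; apply: ler_sum => i _; rewrite !mxE.
set a := u _ _; set b := v _ _; have := sqr_ge0 (a - b); nra.
Qed.

(** It suffices that one of the two coordinates is large, because [rho] dominates both
    [|z'|] and [sqrt |t|]. *)
Lemma rho_ge (z : V) t : 0 <= t ->
  t ^+ 2 <= sqnorm (space_part z) \/ t ^+ 2 <= `|time_part z| -> t <= rho z.
Proof.
move=> t0 h; rewrite /rho -[leLHS](ger0_norm t0) -sqrtr_sqr; apply: ler_wsqrtr.
set A := sqnorm (space_part z) in h *; set b := time_part z in h *.
have A0 : 0 <= A by exact: sqnorm_ge0.
rewrite ler_pdivlMr//; case: h => h.
  have : A <= Num.sqrt (A ^+ 2 + 4 * b ^+ 2).
    rewrite -[leLHS](ger0_norm A0) -sqrtr_sqr; apply: ler_wsqrtr.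
    by rewrite lerDl mulr_ge0// sqr_ge0.
  lra.
have : 2 * `|b| <= Num.sqrt (A ^+ 2 + 4 * b ^+ 2).
  rewrite -[leLHS]ger0_norm ?mulr_ge0// -sqrtr_sqr; apply: ler_wsqrtr.
  rewrite exprMn real_normK ?num_real// (_ : 2 ^+ 2 = 4) ?lerDr ?sqr_ge0//; ring.
lra.
Qed.

(** Seen from a point of the ellipsoid of radius r, a point outside of the
    ellipsoid of radius s >= 4 r is at distance comparable to s. *)
Lemma rho_far (x0 x y : V) r s : 0 < r -> 4 * r <= s ->
  ellipsoid x0 r x -> ~ ellipsoid x0 s y -> s / 4 <= rho (x - y).
Proof.
move=> r0 rs; rewrite /ellipsoid/= => xr /negP; rewrite -leNgt => ys.
have s0 : 0 < s by lra.
have s2 : 0 < s ^+ 2 by rewrite exprn_gt0.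
have s4 : 0 < s ^+ 4 by rewrite exprn_gt0.
have r2 : 0 < r ^+ 2 by rewrite exprn_gt0.
have r4 : 0 < r ^+ 4 by rewrite exprn_gt0.
have rs2 : r ^+ 2 <= s ^+ 2 / 16 by nra.
apply: rho_ge; first by rewrite divr_ge0 ?ltW.
rewrite space_partB time_partB expr_div_n (_ : 4 ^+ 2 = 16); last by ring.
move: xr ys; set A := sqnorm (space_part x0 - space_part x).
set b := (time_part x0 - time_part x).
set A' := sqnorm (space_part x0 - space_part y).
set b' := (time_part x0 - time_part y) => xr ys.
have A0 : 0 <= A by exact: sqnorm_ge0.
have Ar : A < r ^+ 2.
  have : A / r ^+ 2 < 1 by apply: le_lt_trans xr; rewrite lerDl divr_ge0 ?sqr_ge0// ltW.
  by rewrite ltr_pdivrMr// mul1r.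
have br : `|b| < r ^+ 2.
  have : b ^+ 2 / r ^+ 4 < 1 by apply: le_lt_trans xr; rewrite lerDr divr_ge0// ltW.
  rewrite ltr_pdivrMr// mul1r -(ltr_sqrt)// sqrtr_sqr => /lt_le_trans; apply.
  by rewrite (_ : r ^+ 4 = (r ^+ 2) ^+ 2) ?sqrtr_sqr ?gtr0_norm// -exprM.
have [h|h] := leP (1 / 2) (A' / s ^+ 2); [left|right].
  have : A' <= 2 * (A + sqnorm (space_part x - space_part y)).
    by have := sqnormD_le (space_part x0 - space_part x) (space_part x - space_part y);
      rewrite addrA subrK.
  move: h; rewrite ler_pdivlMr//; lra.
have : s ^+ 2 / 2 <= `|b'|.
  have s20 : 0 <= s ^+ 2 / 2 by rewrite divr_ge0 ?ltW.
  have h1 : 1 / 2 <= b' ^+ 2 / s ^+ 4 by lra.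
  rewrite -[leLHS](ger0_norm s20) -!sqrtr_sqr; apply: ler_wsqrtr.
  move: h1; rewrite ler_pdivlMr// => h1; apply: le_trans h1.
  rewrite expr_div_n -exprM (_ : 2 * 2 = 4)%N// (_ : 2 ^+ 2 = 4); last by ring.
  by have := s4; set S := s ^+ 4; lra.
have : `|b'| <= `|b| + `|time_part x - time_part y|.
  by have := ler_normD b (time_part x - time_part y); rewrite /b addrA subrK.
lra.
Qed.

Variable p : R.
Hypothesis p_gt1 : 1 < p.

Definition conj_exp : R := p / (p - 1).
Local Notation q := conj_exp.

Lemma conj_exp_gt1 : 1 < q.
Proof. rewrite /conj_exp ltr_pdivlMr ?subr_gt0// mul1r; lra. Qed.

Lemma conj_expP : p^-1 + q^-1 = 1.
Proof.
have p0 : p != 0 by rewrite gt_eqF// (lt_trans ltr01).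
have p10 : p - 1 != 0 by rewrite gt_eqF// subr_gt0.
by rewrite /conj_exp; field; rewrite p0 p10.
Qed.

Let p_gt0 : 0 < p. Proof. exact: lt_trans p_gt1. Qed.
Let q_gt0 : 0 < q. Proof. exact: lt_trans conj_exp_gt1. Qed.

Variables (a : V -> R) (M : R).
Hypothesis a_bmo : BMO a.
Hypothesis M_gt0 : 0 < M.
Hypothesis a_le : (bmo_norm a <= M%:E)%E.

Let ma : measurable_fun setT a. Proof. by have [[]] := a_bmo. Qed.

Lemma mean_dyadic_dist x r k : 0 < r ->
  `|mean a (ellipsoid x (2 ^+ k * r)) - mean a (ellipsoid x r)|
    <= k%:R * (doubling_const n * M).
Proof.
move=> r0; elim: k => [|k IH]; first by rewrite expr0 mul1r subrr normr0 mul0r.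
rewrite exprS -mulrA -[k.+1%:R]natr1 [leRHS]mulrDl mul1r [leRHS]addrC.
have kr0 : 0 < 2 ^+ k * r by rewrite mulr_gt0// exprn_gt0.
have := ler_normD (mean a (ellipsoid x (2 * (2 ^+ k * r))) - mean a (ellipsoid x (2 ^+ k * r)))
  (mean a (ellipsoid x (2 ^+ k * r)) - mean a (ellipsoid x r)).
rewrite addrA subrK => /le_trans; apply; apply: lerD => //.
exact: (mean_double_dist a_bmo M_gt0 a_le).
Qed.

Definition osc_const : R :=
  (2 `^ q * (2 ^+ n.+1 + jn_const n q)) `^ q^-1 * (1 + doubling_const n).

Lemma osc_base_ge0 : 0 <= 2 `^ q * (2 ^+ n.+1 + jn_const n q) :> R.
Proof. by rewrite mulr_ge0 ?powR_ge0// addr_ge0 ?exprn_ge0 ?jn_const_ge0. Qed.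

Lemma doubling_const_ge0 : 0 <= doubling_const n :> R.
Proof. by rewrite exprn_ge0. Qed.

Lemma osc_const_ge0 : 0 <= osc_const.
Proof. by rewrite mulr_ge0 ?powR_ge0// addr_ge0 ?doubling_const_ge0. Qed.

(** The power [1 / q] of the left side is at most the sum of the Lq norms of the
    constant [e + |m - z|] and of [a - m], where [m] and [z] are the means over the large
    and the small ellipsoid. The first is linear in [j] by [mean_dyadic_dist], the second
    is bounded by the John-Nirenberg inequality. *)
Lemma dyadic_osc x r j (e : R) : 0 < r -> 0 <= e ->
  (\int[mu]_(y in ellipsoid x (dyadic_radius r j))
     (`|e + `|a y - mean a (ellipsoid x r)| | `^ q)%:E <=
   ((osc_const * (j.+3%:R * (e + M)) * dyadic_radius r j `^ (n.+2%:R / q)) `^ q)%:E)%E.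
Proof.
move=> r0 e0; set s := dyadic_radius r j; set z := mean a (ellipsoid x r).
have s0 : 0 < s by rewrite mulr_gt0// exprn_gt0.
set m := mean a (ellipsoid x s).
pose W := j.+3%:R * (e + M) * (1 + doubling_const n).
have D0 := doubling_const_ge0.
have eM : 0 < e + M by rewrite ltr_wpDl.
have W0 : 0 <= W by rewrite !mulr_ge0 ?addr_ge0// ltW.
have mz : `|m - z| <= j.+2%:R * (doubling_const n * M) by exact: mean_dyadic_dist.
have AW : e + `|m - z| <= W.
  apply: (@le_trans _ _ (e + j.+2%:R * (doubling_const n * M))); first by rewrite lerD2l.
  rewrite /W mulrDr mulr1; apply: lerD.
    by apply: (@le_trans _ _ (e + M)); rewrite ?lerDl ?ler_peMl ?ler1n// ltW.
  rewrite -mulrA [(e + M) * _]mulrC; apply: ler_pM => //.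
  - by rewrite mulr_ge0// ltW.
  - by rewrite ler_nat.
  - by rewrite ler_wpM2l// lerDr.
have MW : M <= W.
  apply: (@le_trans _ _ (e + M)); first by rewrite lerDr.
  rewrite /W -mulrA mulrCA ler_peMr ?(ltW eM)//.
  by rewrite -[leLHS]mulr1 ler_pM// ?ler1n// lerDl.
have q0 := ltW q_gt0.
have mE := measurable_ellipsoid x s.
apply: (@le_trans _ _ (\int[mu]_(y in ellipsoid x s) (2 `^ q * `|a y - m| `^ q)%:E +
   \int[mu]_(y in ellipsoid x s) (cst (2 `^ q * W `^ q) y)%:E)%E).
  have md w : measurable_fun setT (fun y => `|a y - w| `^ q).
    apply: (measurableT_comp (measurable_powR q)); apply: measurableT_comp => //.
    exact: measurable_funB.
  apply: le_integralD => //.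
  - by apply: measurable_funTS; exact: measurable_funM.
  - by move=> y _; rewrite mulr_ge0 ?powR_ge0.
  move=> y _ /=; rewrite -mulrDr.
  apply: (@le_trans _ _ ((`|a y - m| + W) `^ q)).
    apply: powR_le => //; rewrite ger0_norm ?addr_ge0//.
    have : `|a y - z| <= `|a y - m| + `|m - z|.
      by have := ler_normD (a y - m) (m - z); rewrite addrA subrK.
    lra.
  exact: powRD_le.
rewrite (integral_cst mu mE (2 `^ q * W `^ q)%:E) volE//.
rewrite integralZ_EFin ?powR_ge0//; last first.
  apply: measurable_funTS; apply: (measurableT_comp (measurable_powR q)).
  by apply: measurableT_comp => //; exact: measurable_funB.
apply: (@le_trans _ _ ((2 `^ q)%:E * (jn_const n q * M `^ q * s ^+ n.+2)%:E +
  (2 `^ q * W `^ q)%:E * (2 ^+ n.+1 * s ^+ n.+2)%:E)%E).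
  apply: leeD; apply: lee_wpmul2l.
  - by rewrite lee_fin powR_ge0.
  - by apply: (john_nirenberg a_bmo M_gt0 a_le) => //; exact/ltW/conj_exp_gt1.
  - by rewrite lee_fin; apply: mulr_ge0; exact: powR_ge0.
  - by rewrite lee_fin; exact: vol_le.
rewrite -!EFinM -EFinD lee_fin.
have -> : osc_const * (j.+3%:R * (e + M)) * s `^ (n.+2%:R / q) =
    (2 `^ q * (2 ^+ n.+1 + jn_const n q)) `^ q^-1 * W * s `^ (n.+2%:R / q).
  by rewrite /osc_const /W; ring.
have base0 := osc_base_ge0.
move: base0; set B := 2 `^ q * (2 ^+ _ + _) => base0.
rewrite (powRM q (mulr_ge0 (powR_ge0 B q^-1) W0) (powR_ge0 s _)).
rewrite (powRM q (powR_ge0 B q^-1) W0) /B.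
rewrite powRVK ?gt_eqF ?osc_base_ge0// -[s `^ _ `^ q]powRrM divfK ?gt_eqF// powR_mulrn ?(ltW s0)//.
rewrite [leRHS](_ : _ = 2 `^ q * (jn_const n q * W `^ q * s ^+ n.+2) +
  2 `^ q * W `^ q * (2 ^+ n.+1 * s ^+ n.+2)); last by ring.
rewrite lerD2r ler_pM2l ?powR_gt0// ler_wpM2r ?exprn_ge0 ?(ltW s0)//.
by rewrite ler_wpM2l ?jn_const_ge0//; apply: powR_le => //; exact: ltW.
Qed.

End far_field.

Section far_integral.
Context {R : realType} (n : nat).

Local Notation V := 'rV[R]_n.+1.
Local Notation mu := (@lebesgue_rV R n.+1).
Variable p : R.
Hypothesis p_gt1 : 1 < p.
Local Notation Qp := (n.+2%:R / p : R).
Local Notation q := (conj_exp p).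
Variables (a : V -> R) (M : R).
Hypothesis a_bmo : BMO a.
Hypothesis M_gt0 : 0 < M.
Hypothesis a_le : (bmo_norm a <= M%:E)%E.

Let ma : measurable_fun setT a. Proof. by have [[]] := a_bmo. Qed.
Let p_gt0 : 0 < p. Proof. exact: lt_trans p_gt1. Qed.

Definition far_const : R := 8 ^+ n.+2 * osc_const n p.

Lemma far_const_ge0 : 0 <= far_const.
Proof. by rewrite mulr_ge0 ?exprn_ge0 ?osc_const_ge0. Qed.

Lemma dyadic_shell (P : nat -> Prop) J : ~ P 0%N -> P J ->
  exists2 j, (j < J)%N & ~ P j /\ P j.+1.
Proof.
move=> P0; elim: J => [//|J IH] PJ.
have [PJ'|nPJ] := pselect (P J); last by exists J.
by have [j jJ h] := IH PJ'; exists j => //; rewrite ltnS ltnW.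
Qed.

(** On each dyadic shell the kernel is comparable to the inverse volume, and Hoelder's
    inequality separates [f] from the symbol. The constant does not depend on the number
    [J] of shells, so that [g] may be any part of [f] with bounded support away from the
    centre. *)
Lemma far_integral (f g : V -> R) x0 r J x : Lp_loc p f -> 0 < r ->
  ellipsoid x0 r x -> (forall y, `|g y| <= `|f y|) ->
  (forall y, ellipsoid x0 (dyadic_radius r 0) y -> g y = 0) ->
  (forall y, g y != 0 -> ellipsoid x0 (dyadic_radius r J) y) ->
  (\int[mu]_y (`|a x - a y| * (`|g y| / rho (x - y) ^+ n.+2))%:E <=
   (far_const * (`|a x - mean a (ellipsoid x0 r)| + M) *
     \sum_(j < J) j.+4%:R * (dyadic_radius r j.+1 `^ (- Qp) *
        local_norm p f x0 (dyadic_radius r j.+1)))%:E)%E.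
Proof.
move=> lf r0 xr gf g0 gJ; set s := dyadic_radius r in g0 gJ *.
set z := mean a (ellipsoid x0 r); set e := `|a x - z|.
have s0 j : 0 < s j by rewrite mulr_gt0// exprn_gt0.
have sS j : s j.+1 = 2 * s j by rewrite /s /dyadic_radius exprS mulrA.
have rs j : 4 * r <= s j.
  rewrite /s /dyadic_radius (_ : 4 = 2 ^+ 2); last by ring.
  by rewrite ler_pM2r// ler_weXn2l// ler1n.
have e0 : 0 <= e by exact: normr_ge0.
pose u y := e + `|a y - z|.
have u0 y : 0 <= u y by rewrite addr_ge0.
have mu_ : measurable_fun setT u.
  apply: measurable_funD => //; apply: measurableT_comp => //; exact: measurable_funB.
pose k j : R := (4 / s j) ^+ n.+2.
have k0 j : 0 <= k j by rewrite exprn_ge0// divr_ge0// ltW.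
pose E j := ellipsoid x0 (s j.+1).
have mE j : measurable (E j) by exact: measurable_ellipsoid.
have mf := lf.1.
pose h j y : R := k j * (`|f y| * `|u y|).
have h0 j y : 0 <= h j y by apply: mulr_ge0 => //; exact: mulr_ge0.
have mh j : measurable_fun setT (h j).
  by apply: measurable_funM => //; apply: measurable_funM; exact: measurableT_comp.
apply: (@le_trans _ _ (\int[mu]_y \sum_(j < J) ((EFin \o h j) \_ (E j)) y)%E).
  apply: le_nonneg_integral => y _.
    by rewrite lee_fin mulr_ge0// divr_ge0// exprn_ge0// sqrtr_ge0.
  have hE0 j : (0 <= ((EFin \o h j) \_ (E j)) y)%E.
    by apply: erestrict_ge0 => t _; rewrite lee_fin.
  have [gy|gy] := eqVneq (g y) 0.
    by rewrite gy normr0 mul0r mulr0; apply: sume_ge0.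
  have [] := @dyadic_shell (fun j => ellipsoid x0 (s j) y) J.
  - by move=> /g0; apply/eqP.
  - exact: gJ.
  move=> j jJ [yj yj1].
  rewrite (bigD1 (Ordinal jJ))//=; apply: (@le_trans _ _ (h j y)%:E); last first.
    by rewrite patchE mem_set// leeDl// sume_ge0.
  have rho_s : s j / 4 <= rho (x - y) by exact: rho_far r0 (rs j) xr yj.
  have s4 : 0 < s j / 4 by rewrite divr_gt0.
  have -> : h j y = u y * (`|f y| * k j) by rewrite /h (ger0_norm (u0 y)); ring.
  rewrite lee_fin; apply: ler_pM => //.
  - by rewrite divr_ge0// exprn_ge0// sqrtr_ge0.
  - have := ler_normD (a x - z) (z - a y); rewrite addrA subrK => /le_trans; apply.
    by rewrite /u /e (distrC z).
  apply: ler_pM => //.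
  - by rewrite invr_ge0 exprn_ge0// sqrtr_ge0.
  - have -> : k j = ((s j / 4) ^+ n.+2)^-1.
      by rewrite /k -exprVn; congr (_ ^+ _); field; rewrite gt_eqF.
    rewrite lef_pV2 ?posrE ?exprn_gt0//; last exact: lt_le_trans rho_s.
    by rewrite lerXn2r// nnegrE ?sqrtr_ge0// ltW.
rewrite ge0_integral_sum//; last 2 first.
- move=> j; apply/(@measurable_restrictT _ _ _ _ (E j) (EFin \o h j)) => //.
  by apply/measurable_EFinP; exact: measurable_funTS.
- by move=> j y _; apply: erestrict_ge0 => t _; rewrite lee_fin.
rewrite mulr_sumr -sumEFin; apply: lee_sum => j _.
rewrite -integral_mkcond /h integralZ_EFin//; last first.
  by apply: measurable_funTS; apply: measurable_funM; exact: measurableT_comp.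
have q1 := conj_exp_gt1 p_gt1.
have q0 : 0 < q by exact: lt_trans q1.
pose B := osc_const n p * (j.+4%:R * (e + M)) * s j.+1 `^ (n.+2%:R / q).
have B0 : 0 <= B.
  rewrite /B mulr_ge0 ?powR_ge0// mulr_ge0 ?osc_const_ge0//.
  by rewrite mulr_ge0// addr_ge0// ltW.
have hol : (\int[mu]_(y in E j) (`|f y| * `|u y|)%:E <=
    (local_norm p f x0 (s j.+1) * B)%:E)%E.
  apply: (@hoelder_le _ _ _ _ _ _ _ p q) => //.
  - exact: conj_expP.
  - exact: local_norm_ge0.
  - by rewrite local_normE.
  - exact: (dyadic_osc p_gt1 a_bmo M_gt0 a_le).
apply: (@le_trans _ _ ((k j)%:E * (local_norm p f x0 (s j.+1) * B)%:E)%E).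
  by apply: lee_wpmul2l => //; rewrite lee_fin.
rewrite -EFinM lee_fin le_eqVlt; apply/orP; left; apply/eqP.
have -> : k j = 8 ^+ n.+2 / s j.+1 ^+ n.+2.
  by rewrite /k sS -expr_div_n; congr (_ ^+ _); field; rewrite gt_eqF.
have qE : n.+2%:R / q = n.+2%:R - Qp.
  by rewrite -[X in X - _]mulr1 -(conj_expP p_gt1) mulrDr addrAC subrr add0r.
have -> : B = osc_const n p * (j.+4%:R * (e + M)) * (s j.+1 ^+ n.+2 * s j.+1 `^ (- Qp)).
  rewrite /B qE powRD ?powR_mulrn// ?(ltW (s0 _))//.
  by apply/implyP => _; rewrite gt_eqF.
rewrite /far_const; field.
by rewrite expf_neq0// gt_eqF.
Qed.

End far_integral.

(** * Supports and truncations *)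

Section truncation.
Context {R : realType} (n : nat).

Local Notation V := 'rV[R]_n.+1.
Local Notation time := (@ord_max n).
Local Notation mu := (@lebesgue_rV R n.+1).

Lemma continuous_coord (i : 'I_n.+1) : continuous (fun y : V => y ord0 i).
Proof. exact: coord_continuous. Qed.

Lemma open_ellipsoid (x : V) r : open (ellipsoid x r).
Proof.
pose g (y : V) := (\sum_(i < n) (x ord0 (widen_ord (leqnSn n) i) -
    y ord0 (widen_ord (leqnSn n) i)) ^+ 2) / r ^+ 2 +
    (time_part x - time_part y) ^+ 2 / r ^+ 4.
rewrite (_ : ellipsoid x r = g @^-1` [set t | t < 1]); last first.
  by apply/seteqP; split => y; rewrite /ellipsoid /g /= sqnorm_space.
apply: open_comp; last exact: open_lt.
have sq i : continuous (fun y : V => (x ord0 i - y ord0 i) ^+ 2).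
  move=> y; pose d (y : V) := x ord0 i - y ord0 i.
  have cd : {for y, continuous d}.
    apply: (@continuousB _ _ _ (fun=> x ord0 i) (fun y : V => y ord0 i)).
      exact: cst_continuous.
    exact: continuous_coord.
  exact: (continuous_comp cd (@exprn_continuous _ 2 _)).
have csum : continuous (fun y : V => \sum_(i < n)
    (x ord0 (widen_ord (leqnSn n) i) - y ord0 (widen_ord (leqnSn n) i)) ^+ 2).
  by apply: continuous_big => [|i _]; [exact: add_continuous|exact: sq].
move=> y _; pose g1 (y : V) := (\sum_(i < n) (x ord0 (widen_ord (leqnSn n) i) -
    y ord0 (widen_ord (leqnSn n) i)) ^+ 2) / r ^+ 2.
pose g2 (y : V) := (time_part x - time_part y) ^+ 2 / r ^+ 4.
have c1 : {for y, continuous g1}.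
  exact: (@continuousM _ _ _ (fun=> (r ^+ 2)^-1) y (csum y) (@cst_continuous _ _ _ y)).
have c2 : {for y, continuous g2}.
  exact: (@continuousM _ _ _ (fun=> (r ^+ 4)^-1) y (sq time y) (@cst_continuous _ _ _ y)).
exact: (continuousD c1 c2).
Qed.

Lemma compact_supp (g : V -> R) x s : 0 < s ->
  (forall y, g y != 0 -> ellipsoid x s y) -> compact (supp g).
Proof.
move=> s0 gs; apply: subclosed_compact.
- exact: closed_closure.
- exact: (@closed_box_compact _ _ x s).
have /closure_id -> : closed [set y : V | forall i, `[x ord0 i - pradius s i, x ord0 i + pradius s i]%classic (y ord0 i)].
  by apply: compact_closed; [exact: norm_hausdorff|exact: closed_box_compact].
apply: closureS => y /= /gs/(ellipsoid_cylinder s0) yx i.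
by have /andP[/ltW ? /ltW ?] := yx i; rewrite /= in_itv/=; apply/andP.
Qed.

Lemma not_supp (g : V -> R) x0 s x :
  (forall y, ellipsoid x0 s y -> g y = 0) -> ellipsoid x0 s x -> ~ supp g x.
Proof.
move=> g0 xs; rewrite /supp /closure/= => /(_ (ellipsoid x0 s)) [].
  by apply: open_nbhs_nbhs; split => //; exact: open_ellipsoid.
by move=> y [/= gy yE]; move: gy; rewrite g0// eqxx.
Qed.

(** With [t >= 1] both terms of the equation of the large ellipsoid are at most a
    constant over [t], whence the sum [A + B + 1] as threshold. *)
Lemma ellipsoid_absorb (x x0 : V) s : 0 < s ->
  exists2 t0, 0 < t0 & forall t, t0 <= t -> ellipsoid x0 s `<=` ellipsoid x t.
Proof.
move=> s0; pose A := 2 * (sqnorm (space_part x - space_part x0) + s ^+ 2).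
pose B := 2 * ((time_part x - time_part x0) ^+ 2 + s ^+ 4).
have A0 : 0 <= A by rewrite mulr_ge0// addr_ge0 ?sqnorm_ge0 ?exprn_ge0// ltW.
have B0 : 0 <= B by rewrite mulr_ge0// addr_ge0 ?sqr_ge0 ?exprn_ge0// ltW.
exists (A + B + 1); first by rewrite ltr_wpDl ?addr_ge0.
move=> t tAB y; rewrite /ellipsoid/= => ys.
have t1 : 1 <= t by apply: le_trans tAB; rewrite lerDr addr_ge0.
have t0 : 0 < t by exact: lt_le_trans t1.
have s2 : 0 < s ^+ 2 by rewrite exprn_gt0.
have s4 : 0 < s ^+ 4 by rewrite exprn_gt0.
have yA : sqnorm (space_part x - space_part y) <= A.
  have : sqnorm (space_part x0 - space_part y) <= s ^+ 2.
    have : sqnorm (space_part x0 - space_part y) / s ^+ 2 < 1.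
      by apply: le_lt_trans ys; rewrite lerDl divr_ge0 ?sqr_ge0// ltW.
    by rewrite ltr_pdivrMr// mul1r => /ltW.
  have := sqnormD_le (space_part x - space_part x0) (space_part x0 - space_part y).
  rewrite addrA subrK /A; lra.
have yB : (time_part x - time_part y) ^+ 2 <= B.
  have : (time_part x0 - time_part y) ^+ 2 <= s ^+ 4.
    have : (time_part x0 - time_part y) ^+ 2 / s ^+ 4 < 1.
      by apply: le_lt_trans ys; rewrite lerDr divr_ge0 ?sqnorm_ge0// ltW.
    by rewrite ltr_pdivrMr// mul1r => /ltW.
  rewrite /B; set u := time_part x; set v := time_part x0; set w := time_part y.
  by have := sqr_ge0 (u - v - (v - w)); nra.
have tk k d : 0 <= d -> (0 < k)%N -> d / t ^+ k <= d / t.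
  move=> d0 k0; rewrite ler_wpM2l// lef_pV2 ?posrE ?exprn_gt0//.
  by rewrite -[leLHS]expr1 ler_weXn2l.
apply: (@le_lt_trans _ _ (A / t + B / t)).
  apply: lerD; [apply: le_trans (tk 2%N A A0 isT)|apply: le_trans (tk 4%N B B0 isT)].
  - by rewrite ler_pM2r// invr_gt0 exprn_gt0.
  - by rewrite ler_pM2r// invr_gt0 exprn_gt0.
by rewrite -mulrDl ltr_pdivrMr// mul1r; lra.
Qed.

Lemma compact_sub_ellipsoid (K : set V) (x : V) : compact K ->
  exists2 t, 0 < t & K `<=` ellipsoid x t.
Proof.
rewrite compact_cover => /(_ nat setT (fun k => ellipsoid x k.+1%:R)) [].
- by move=> k _; exact: open_ellipsoid.
- move=> y _; have [t0 t00 h] := @ellipsoid_absorb x y 1 ltr01.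
  exists (Num.Def.archi_bound t0) => //; apply: h.
    by rewrite (le_trans (ltW (archi_boundP (ltW t00))))// ler_nat.
  rewrite /ellipsoid/= !subrr expr0n/= mul0r addr0 /sqnorm big1 ?mul0r// => i _.
  by rewrite !mxE expr0n.
move=> D _ KD; pose m := (\max_(k <- D) k).+1.
exists m%:R; first by rewrite ltr0n.
move=> y /KD [k /= kD]; apply: subset_ellipsoid; first by rewrite ltr0n.
by rewrite ler_nat ltnS; exact: leq_bigmax_seq.
Qed.

Variable p : R.
Hypothesis p_gt1 : 1 < p.

Let p_gt0 : 0 < p. Proof. exact: lt_trans p_gt1. Qed.
Let p_neq0 : p != 0. Proof. by rewrite gt_eqF. Qed.

Lemma Lnorm_powRE (g : V -> R) :
  ('N[mu]_p%:E[EFin \o g] = (\int[mu]_y (`|g y| `^ p)%:E) `^ p^-1)%E.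
Proof. by rewrite unlock. Qed.

Lemma Lnorm_le (g : V -> R) L : 0 <= L ->
  (\int[mu]_y (`|g y| `^ p)%:E <= (L `^ p)%:E)%E <-> ('N[mu]_p%:E[EFin \o g] <= L%:E)%E.
Proof.
move=> L0; rewrite Lnorm_powRE.
have i0 : (0 <= \int[mu]_y (`|g y| `^ p)%:E)%E.
  by apply: integral_ge0 => y _; rewrite lee_fin powR_ge0.
split => h.
  have : ((\int[mu]_y (`|g y| `^ p)%:E) `^ p^-1 <= ((L `^ p)%:E) `^ p^-1)%E.
    apply: gt0_ler_poweR => //; rewrite ?invr_ge0 ?(ltW p_gt0)//.
      by rewrite in_itv/= i0 leey.
    by rewrite in_itv/= lee_fin powR_ge0 leey.
  by move=> /le_trans; apply; rewrite poweR_EFin powRK.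
have : (((\int[mu]_y (`|g y| `^ p)%:E) `^ p^-1) `^ p <= (L%:E) `^ p)%E.
  apply: gt0_ler_poweR => //; rewrite ?(ltW p_gt0)//.
    by rewrite in_itv/= poweR_ge0 leey.
  by rewrite in_itv/= lee_fin L0 leey.
by rewrite -poweRrM mulVf// poweRe1.
Qed.

Lemma integral_trunc (g : V -> R) A : measurable A ->
  (\int[mu]_y (`|(g \* \1_A)%R y| `^ p)%:E = \int[mu]_(y in A) (`|g y| `^ p)%:E)%E.
Proof.
move=> mA; rewrite [RHS]integral_mkcond; apply: eq_integral => y _.
rewrite patchE /= indicE; case: ifPn => yA /=; first by rewrite mulr1.
by rewrite mulr0 normr0 powR0.
Qed.

Lemma measurable_trunc (g : V -> R) A : measurable A -> measurable_fun setT g ->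
  measurable_fun setT (g \* \1_A : V -> R).
Proof. by move=> mA mg; apply: measurable_funM => //; exact: measurable_indic. Qed.

Lemma Lp_trunc (g : V -> R) A : measurable A -> measurable_fun setT g ->
  (\int[mu]_(y in A) (`|g y| `^ p)%:E < +oo)%E -> Lp p (g \* \1_A).
Proof.
move=> mA mg gA; split; first exact: measurable_trunc.
by rewrite /finite_norm Lnorm_powRE integral_trunc// poweR_lty.
Qed.

(** The truncations are in L1, as the kernel bound requires, because
    [|g| <= 1 + |g| ^ p] on a set of finite measure. *)
Lemma integrable_trunc (g : V -> R) A x s : Lp_loc p g -> measurable A -> 0 < s ->
  A `<=` ellipsoid x s -> mu.-integrable setT (EFin \o (g \* \1_A : V -> R)).
Proof.
move=> lg mA s0 As; have mg := lg.1; have mE := measurable_ellipsoid x s.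
have mgA := measurable_trunc mA mg.
apply/integrableP; split; first exact/measurable_EFinP.
apply: (@le_lt_trans _ _ (\int[mu]_(y in ellipsoid x s) (cst 1 y)%:E +
    \int[mu]_(y in ellipsoid x s) (`|g y| `^ p)%:E)%E); last first.
  rewrite (integral_cst mu mE 1%:E) mul1e lte_add_pinfty//; first by rewrite volE// ltry.
  exact: integral_norm_powR_fin.
rewrite (_ : integral mu setT _ = \int[mu]_(y in ellipsoid x s) `|(g \* \1_A) y|%:E)%E; last first.
  rewrite [RHS]integral_mkcond; apply: eq_integral => y _.
  rewrite patchE /= indicE; case: ifPn => yE //.
  rewrite memNset ?mulr0 ?normr0// => /As yE'.
  by move/negP: yE; apply; exact/mem_set.
apply: le_integralD => //.
- exact: measurable_norm_powR.
move=> y _ /=; apply: (@le_trans _ _ `|g y|).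
  by rewrite normrM ler_piMr// indicE; case: (_ \in _); rewrite ?normr1 ?normr0.
have [g1|g1] := leP `|g y| 1; first by rewrite (le_trans g1)// lerDl powR_ge0.
by rewrite (le_trans (le1r_powR (ltW g1) (ltW p_gt1)))// lerDr.
Qed.

End truncation.

Section tail.
Context {R : realType} (n : nat).
Local Notation V := 'rV[R]_n.+1.
Local Notation mu := (@lebesgue_rV R n.+1).

Lemma integral_tail (h : V -> R) e : measurable_fun setT h -> (forall y, 0 <= h y) ->
  (\int[mu]_y (h y)%:E < +oo)%E -> 0 < e ->
  exists k0, forall k, (k0 <= k)%N ->
    (\int[mu]_(y in ~` ellipsoid (0 : V) k.+1%:R) (h y)%:E <= e%:E)%E.
Proof.
move=> mh h0 hfin e0; pose F k := ellipsoid (0 : V) k.+1%:R.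
have mF k : measurable (F k) by exact: measurable_ellipsoid.
have ndF : nondecreasing_seq F.
  move=> i j ij; apply/subsetPset; apply: subset_ellipsoid; first by rewrite ltr0n.
  by rewrite ler_nat.
have UF : \bigcup_k F k = setT.
  apply/seteqP; split => // y _; have [t0 t00 h1] := @ellipsoid_absorb R n 0 y 1 ltr01.
  exists (Num.Def.archi_bound t0) => //; apply: h1.
    by rewrite (le_trans (ltW (archi_boundP (ltW t00))))// ler_nat.
  rewrite /ellipsoid/= !subrr expr0n/= mul0r addr0 /sqnorm big1 ?mul0r// => i _.
  by rewrite !mxE expr0n.
have mhF k : measurable_fun (F k) (EFin \o h).
  by apply/measurable_EFinP; exact: measurable_funTS.
have h0F k x : F k x -> (0 <= (EFin \o h) x)%E by rewrite /= lee_fin.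
have split k : (\int[mu]_y (h y)%:E = \int[mu]_(y in F k) (h y)%:E +
    \int[mu]_(y in ~` F k) (h y)%:E)%E.
  rewrite -ge0_integral_setU//; first by rewrite setUv.
  - exact: measurableC.
  - by apply/measurable_EFinP; exact: measurable_funTS.
  - by move=> x _; rewrite lee_fin.
  - by apply/eqP; rewrite setICr.
have ifin : (\int[mu]_y (h y)%:E)%E \is a fin_num.
  by rewrite ge0_fin_numE//; apply: integral_ge0 => y _; rewrite lee_fin.
have Ffin k : (\int[mu]_(y in F k) (h y)%:E)%E \is a fin_num.
  rewrite ge0_fin_numE; last by apply: integral_ge0 => y _; rewrite lee_fin.
  apply: le_lt_trans hfin; rewrite (split k) leeDl//.
  by apply: integral_ge0 => y _; rewrite lee_fin.
have := @ge0_nondecreasing_set_cvg_integral _ _ _ F (EFin \o h) mu ndF mF mhF h0F.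
rewrite UF -[X in _ --> X]fineK// => /fine_cvgP[_ /cvgrPdist_le/(_ _ e0)] [k0 _ hk0].
exists k0 => k kk0; have := hk0 k kk0.
have := split k; rewrite -[LHS]fineK// -[X in (_ = X + _)%E]fineK//.
set I := fine _; set J := fine _ => IJ /=.
rewrite -[fine _]/J => h2.
have -> : (\int[mu]_(y in ~` ellipsoid (0 : V) k.+1%:R) (h y)%:E = (I - J)%:E)%E.
  by rewrite EFinB IJ addeAC subee// add0e.
by rewrite lee_fin (le_trans (ler_norm _)).
Qed.

End tail.

(** * The local estimate *)

Section local_estimate.
Context {R : realType} (n : nat).
Local Notation V := 'rV[R]_n.+1.
Local Notation mu := (@lebesgue_rV R n.+1).
Local Notation Qp p := (n.+2%:R / p : R).
Variable p : R.
Hypothesis p_gt1 : 1 < p.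
Variable phi : V -> R -> R.
Hypothesis phi_gt0 : forall x r, 0 < r -> 0 < phi x r.
Variable C0 : R.
Hypothesis C0_gt0 : 0 < C0.
Hypothesis phi_cond : forall x r, 0 < r ->
  (\int[@lebesgue_measure R]_(s in `]r, +oo[)
     ((1 + ln (s / r))%:E *
      (essinf_tail p phi x s * ((s `^ (Qp p + 1))^-1)%:E))
   <= (C0 * phi x r)%:E)%E.

Let p_gt0 : 0 < p. Proof. exact: lt_trans p_gt1. Qed.
Let p_ge0 : 0 <= p. Proof. exact: ltW. Qed.
Let p_neq0 : p != 0. Proof. by rewrite gt_eqF. Qed.

Variables (a : V -> R) (M : R).
Hypothesis a_bmo : BMO a.
Hypothesis M_gt0 : 0 < M.
Hypothesis a_le : (bmo_norm a <= M%:E)%E.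

Let ma : measurable_fun setT a. Proof. by have [[]] := a_bmo. Qed.

(** The operator for the fixed symbol [a]. *)
Variable S : (V -> R) -> (V -> R).
Hypothesis S_sublinear : forall f g, Lp p f -> Lp p g ->
  {ae mu, forall x, `|S (f \+ g) x| <= `|S f x| + `|S g x|}.
Variable C1 : R.
Hypothesis C1_gt0 : 0 < C1.
Hypothesis S_pointwise : forall f, mu.-integrable setT (EFin \o f) -> compact (supp f) ->
  forall x, ~ supp f x ->
  (`|S f x|%:E <= C1%:E * \int[mu]_y (`|a x - a y| * (`|f y| / rho (x - y) ^+ n.+2))%:E)%E.
Variable C2 : R.
Hypothesis C2_gt0 : 0 < C2.
Hypothesis S_Lp : forall f, Lp p f -> Lp p (S f) /\
  ('N[mu]_(p%:E)[EFin \o S f] <= C2%:E * bmo_norm a * 'N[mu]_(p%:E)[EFin \o f])%E.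

Lemma S_norm_le (f : V -> R) L : Lp p f -> 0 <= L ->
  (\int[mu]_y (`|f y| `^ p)%:E <= (L `^ p)%:E)%E ->
  (\int[mu]_y (`|S f y| `^ p)%:E <= ((C2 * M * L) `^ p)%:E)%E.
Proof.
move=> pf L0 fL; have CM0 : 0 <= C2 * M by rewrite mulr_ge0 ?ltW.
apply/(Lnorm_le p_gt1); first exact: mulr_ge0.
apply: (le_trans (S_Lp pf).2); rewrite [in leRHS]EFinM; apply: lee_pmul => //.
- rewrite mule_ge0 ?lee_fin ?(ltW C2_gt0)//.
  exact: bmo_norm_ge0.
- exact: Lnorm_ge0.
- by rewrite EFinM; apply: lee_wpmul2l => //; rewrite lee_fin ltW.
- by apply/(Lnorm_le p_gt1).
Qed.

Variables (f : V -> R) (N : R).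
Hypothesis lf : Lp_loc p f.
Hypothesis N_gt0 : 0 < N.
Hypothesis f_le : (morrey_norm p phi f <= N%:E)%E.

Let mf : measurable_fun setT f. Proof. exact: lf.1. Qed.

Variables (x0 : V) (r : R).
Hypothesis r_gt0 : 0 < r.

Local Notation s := (dyadic_radius r).
Local Notation E := (ellipsoid x0 r).
Local Notation E4 := (ellipsoid x0 (s 0%N)).
Local Notation Ek k := (ellipsoid (0 : V) k.+1%:R).

(** [f1] is the near part of [f], [H] the bound of [morrey_growth], and [G] the pointwise
    bound on the contribution of the part of [f] outside of [E4]. *)
Let z := mean a E.
Let H := growth_const n p * C0 * N * phi x0 r.
Let f1 := f \* \1_E4.
Let G x := C1 * (far_const n p * (`|a x - z| + M) * H).

Let s_gt0 j : 0 < s j.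
Proof. by rewrite mulr_gt0// exprn_gt0. Qed.

Let growth_const_gt0 : 0 < growth_const n p.
Proof. by rewrite divr_gt0 ?powR_gt0// ln_gt0// ltr1n. Qed.

Let H_ge0 : 0 <= H.
Proof.
apply: mulr_ge0; last exact/ltW/phi_gt0.
apply: mulr_ge0; last exact: ltW.
by apply: mulr_ge0; exact: ltW.
Qed.

Let growth J : \sum_(j < J) j.+3%:R * (s j `^ (- Qp p) * local_norm p f x0 (s j)) <= H.
Proof. by apply: (morrey_growth p_gt1 phi_gt0 lf N_gt0 f_le phi_cond). Qed.

Let near_norm : local_norm p f x0 (s 0%N) <= s 0%N `^ Qp p * H.
Proof.
have := growth 1; rewrite big_ord1 => h.
have t0 : 0 <= s 0%N `^ (- Qp p) * local_norm p f x0 (s 0%N).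
  by rewrite mulr_ge0 ?powR_ge0 ?local_norm_ge0.
have {}h : s 0%N `^ (- Qp p) * local_norm p f x0 (s 0%N) <= H.
  by apply: le_trans h; rewrite ler_peMl// ler1n.
rewrite -ler_pdivrMl ?powR_gt0//.
by move: h; rewrite powRN.
Qed.

Let far_sum J : \sum_(j < J) j.+4%:R * (s j.+1 `^ (- Qp p) * local_norm p f x0 (s j.+1)) <= H.
Proof.
apply: le_trans (growth J.+1); rewrite big_ord_recl/= lerDr.
apply: mulr_ge0 => //; apply: mulr_ge0; first exact: powR_ge0.
exact: local_norm_ge0.
Qed.

Let G_ge0 x : 0 <= G x.
Proof.
apply: mulr_ge0; first exact: ltW.
apply: mulr_ge0 => //; apply: mulr_ge0; first exact: far_const_ge0.
by apply: addr_ge0 => //; exact: ltW.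
Qed.

Let mG : measurable_fun setT G.
Proof.
apply: measurable_funM => //; apply: measurable_funM => //; apply: measurable_funM => //.
apply: measurable_funD => //; apply: measurableT_comp => //; exact: measurable_funB.
Qed.

Let sub_E4 : E `<=` E4.
Proof.
apply: subset_ellipsoid => //; rewrite /dyadic_radius ler_peMl ?(ltW r_gt0)//.
by rewrite exprn_ege1// ler1n.
Qed.

(** The bound [G] does not depend on the bounded set [A], however far it extends. *)
Let far_part A t x : measurable A -> 0 < t -> A `<=` ellipsoid 0 t ->
  (forall y, E4 y -> ~ A y) -> E x -> `|S (f \* \1_A) x| <= G x.
Proof.
move=> mA t0 At AE4 Ex.
have gE4 y : E4 y -> (f \* \1_A) y = 0.
  by move=> /AE4 nA; rewrite /= indicE memNset// mulr0.
have gA y : (f \* \1_A) y != 0 -> ellipsoid 0 t y.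
  rewrite /= indicE; case: (boolP (y \in A)) => [/set_mem/At//|_].
  by rewrite mulr0 eqxx.
have [u0 u00 hu] := @ellipsoid_absorb R n x0 0 t t0.
pose J := Num.Def.archi_bound (u0 / r).
have uJ : u0 <= s J.
  have := archi_boundP (divr_ge0 (ltW u00) (ltW r_gt0)); rewrite -/J ltr_pdivrMr// => h.
  rewrite (le_trans (ltW h))// /dyadic_radius ler_pM2r//.
  rewrite -natrX ler_nat (leq_trans (ltnW (ltn_expl J (ltnSn 1))))// leq_exp2l//.
  by rewrite ltnW.
rewrite -lee_fin; apply: (le_trans (S_pointwise _ _ _)).
- exact: (integrable_trunc p_gt1 lf mA t0 At).
- exact: (compact_supp t0 gA).
- exact: (not_supp gE4 (sub_E4 Ex)).
rewrite /G EFinM; apply: lee_wpmul2l; first by rewrite lee_fin ltW.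
apply: (le_trans (far_integral p_gt1 a_bmo M_gt0 a_le (J := J) lf r_gt0 Ex _ gE4 _)).
- move=> y; rewrite normrM ler_piMr// indicE.
  by case: (_ \in _); rewrite ?normr1 ?normr0.
- by move=> y /gA; exact: hu.
rewrite lee_fin; apply: ler_wpM2l; last exact: far_sum.
apply: mulr_ge0; first exact: far_const_ge0.
by apply: addr_ge0 => //; exact: ltW.
Qed.

Let Lp_f1 : Lp p f1.
Proof.
apply: Lp_trunc => //; first exact: measurable_ellipsoid.
exact: integral_norm_powR_fin.
Qed.

Let near_part : (\int[mu]_y (`|S f1 y| `^ p)%:E <=
  ((C2 * M * (s 0%N `^ Qp p * H)) `^ p)%:E)%E.
Proof.
apply: S_norm_le => //; first by rewrite mulr_ge0 ?powR_ge0.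
rewrite integral_trunc//; last exact: measurable_ellipsoid.
rewrite local_normE// lee_fin; apply: powR_le => //; exact: local_norm_ge0.
Qed.

Let Lp_fk k : Lp p (f \* \1_(Ek k)).
Proof.
apply: Lp_trunc => //; first exact: measurable_ellipsoid.
by apply: integral_norm_powR_fin => //; rewrite ltr0n.
Qed.

(** [f \* \1_(Ek k)] is [f1] plus a truncation of the far part as soon as [Ek k]
    contains [E4]. *)
Let split_fk : exists k0, forall k, (k0 <= k)%N ->
  {ae mu, forall x, E x -> `|S (f \* \1_(Ek k)) x| <= `|S f1 x| + G x}.
Proof.
have [u0 u00 hu] := @ellipsoid_absorb R n 0 x0 (s 0%N) (s_gt0 0%N).
exists (Num.Def.archi_bound u0) => k k0k.
have uk : u0 <= k.+1%:R.
  rewrite (le_trans (ltW (archi_boundP (ltW u00))))// ler_nat.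
  by rewrite (leq_trans k0k).
have sub := hu _ uk.
pose A := Ek k `\` E4.
have mA : measurable A by apply: measurableD; exact: measurable_ellipsoid.
have Ak : A `<=` Ek k by exact: subDsetl.
have k1 : 0 < k.+1%:R :> R by rewrite ltr0n.
have pA : Lp p (f \* \1_A).
  apply: Lp_trunc => //.
  apply: le_lt_trans (integral_norm_powR_fin 0 lf k1).
  by apply: le_nonneg_integral_set => // y; rewrite lee_fin powR_ge0.
have -> : f \* \1_(Ek k) = f1 \+ (f \* \1_A).
  apply/funext => y; rewrite /f1 /= -mulrDr; congr (_ * _).
  rewrite !indicE in_setD; have [yE|yE] := boolP (y \in E4).
    by rewrite (mem_set (sub _ (set_mem yE)))/= addr0.
  by rewrite andbT add0r.
have [B [mB B0 hB]] := S_sublinear Lp_f1 pA.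
exists B; split => //; apply: subset_trans hB => x /=; apply: contra_not => h Ex.
apply: (le_trans h); rewrite lerD2l; apply: (far_part mA k1 Ak) => //.
by move=> y yE [_].
Qed.

Hypothesis det : determined_on_Lp p S f.

Lemma measurable_S : measurable_fun setT (S f).
Proof. by case: det => [/S_Lp[[]]//|[]]. Qed.

Let CM_gt0 : 0 < C2 * M. Proof. exact: mulr_gt0. Qed.

(** The passage from the truncations of [f] to [f]. If [S f] is defined by truncation, the
    bound for the truncations carries over with [w = 0]. If [f] is in Lp, then [w] is the
    image of the part of [f] outside of a large ellipsoid, small by boundedness in Lp. *)
Let pointwise e : 0 < e -> exists w : V -> R, [/\ measurable_fun setT w,
  (\int[mu]_(y in E) (`|w y| `^ p)%:E <= e%:E)%E &
  {ae mu, forall x, E x -> `|S f x| <= `|S f1 x| + G x + `|w x|}].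
Proof.
move=> e0; have [k0 hk0] := split_fk.
have mE := measurable_ellipsoid x0 r.
case: det => [pf|[mSf limf]].
  have ffin : (\int[mu]_y (`|f y| `^ p)%:E < +oo)%E.
    apply: (@lty_poweRy _ _ p^-1); first by rewrite invr_neq0.
    by have := pf.2; rewrite /finite_norm Lnorm_powRE.
  pose d := (e `^ p^-1 / (C2 * M)) `^ p.
  have d0 : 0 < d by rewrite !powR_gt0// divr_gt0 ?powR_gt0.
  have mfp : measurable_fun setT (fun y => `|f y| `^ p) by exact: measurable_norm_powR.
  have [k1 hk1] := integral_tail mfp (fun y => powR_ge0 _ _) ffin d0.
  pose k := maxn k0 k1; pose g := f \* \1_(~` Ek k).
  have mC : measurable (~` Ek k) by apply: measurableC; exact: measurable_ellipsoid.
  have pg : Lp p g.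
    apply: Lp_trunc => //; apply: le_lt_trans (hk1 k (leq_maxr _ _)) _; exact: ltry.
  exists (S g); split.
  - by have [[]] := S_Lp pg.
  - apply: (@le_trans _ _ (\int[mu]_y (`|S g y| `^ p)%:E)%E).
      by apply: le_nonneg_integral_set => // y; rewrite lee_fin powR_ge0.
    apply: (le_trans (S_norm_le (L := e `^ p^-1 / (C2 * M)) pg _ _)).
    + by rewrite divr_ge0 ?powR_ge0// ltW.
    + by rewrite integral_trunc//; apply: hk1; exact: leq_maxr.
    by rewrite lee_fin mulrC divfK ?gt_eqF// powRVK// ltW.
  - have fE : f = (f \* \1_(Ek k)) \+ g.
      apply/funext => y; rewrite /g /= -mulrDr !indicE in_setC.
      by case: (y \in Ek k); rewrite /= ?addr0 ?add0r mulr1.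
    have := S_sublinear (Lp_fk k) pg; rewrite -fE.
    have := hk0 k (leq_maxl _ _).
    apply: filterS2 => x h1 h2 Ex; apply: (le_trans h2).
    by rewrite lerD2r; exact: h1.
exists (cst 0); split => //.
  under eq_integral do rewrite /= normr0 powR0//.
  by rewrite integral0 lee_fin ltW.
have : {ae mu, forall x, forall k, E x ->
    `|S (f \* \1_(Ek (k0 + k)%N)) x| <= `|S f1 x| + G x}.
  by apply: ae_foralln => k; apply: hk0; exact: leq_addr.
move: limf; apply: filterS2 => x h1 h2 Ex.
rewrite /= normr0 addr0 -lee_fin; apply: (le_trans h1).
apply: ge_ereal_inf; exists (ereal_sup ((fun k : nat => `|S (f \* \1_(Ek k))%R x|%:E)
    @` [set k | (k0 <= k)%N])).
  by exists [set k | (k0 <= k)%N] => //; exists k0.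
apply: ge_ereal_sup => _ [k /= k0k <-]; rewrite lee_fin.
by have := h2 (k - k0)%N Ex; rewrite subnKC.
Qed.

Definition near_const : R := C2 * 4 `^ Qp p * (growth_const n p * C0).
Definition far_part_const : R := C1 * far_const n p * (growth_const n p * C0).

Definition local_const : R := 4 `^ p * (near_const `^ p +
  far_part_const `^ p * (2 `^ p * (jn_const n p + 2 ^+ n.+1))).

Let K : R := C1 * far_const n p * H.

Let K_ge0 : 0 <= K.
Proof. by apply: mulr_ge0 => //; apply: mulr_ge0; [exact: ltW|exact: far_const_ge0]. Qed.

(** The symbol enters [G] only through [|a - z|], whose p-th power is integrated over
    [E] by the John-Nirenberg inequality. *)
Let integral_G : (\int[mu]_(y in E) (G y `^ p)%:E <=
  (K `^ p * (2 `^ p * (jn_const n p + 2 ^+ n.+1)) * M `^ p * r ^+ n.+2)%:E)%E.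
Proof.
have mE := measurable_ellipsoid x0 r.
have M0 := ltW M_gt0.
have md : measurable_fun setT (fun y => `|a y - z| `^ p).
  apply: (measurableT_comp (measurable_powR p)); apply: measurableT_comp => //.
  exact: measurable_funB.
have Kp0 : 0 <= K `^ p * 2 `^ p by apply: mulr_ge0; exact: powR_ge0.
apply: (@le_trans _ _ (\int[mu]_(y in E) (K `^ p * 2 `^ p * `|a y - z| `^ p)%:E +
   \int[mu]_(y in E) (cst (K `^ p * 2 `^ p * M `^ p) y)%:E)%E).
  apply: le_integralD => //.
  - by apply: measurable_funTS; exact: measurable_funM.
  - by move=> y _; apply: mulr_ge0 => //; exact: powR_ge0.
  - by move=> y _ /=; apply: mulr_ge0 => //; exact: powR_ge0.
  - by move=> y _; exact: powR_ge0.
  move=> y _ /=.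
  have -> : G y = K * (`|a y - z| + M) by rewrite /G /K; ring.
  rewrite powRM ?addr_ge0// -mulrDr -mulrA; apply: ler_wpM2l; first exact: powR_ge0.
  exact: powRD_le.
rewrite (integral_cst mu mE (K `^ p * 2 `^ p * M `^ p)%:E) volE//.
rewrite integralZ_EFin//; last exact: measurable_funTS.
apply: (@le_trans _ _ ((K `^ p * 2 `^ p)%:E * (jn_const n p * M `^ p * r ^+ n.+2)%:E +
  (K `^ p * 2 `^ p * M `^ p)%:E * (2 ^+ n.+1 * r ^+ n.+2)%:E)%E).
  apply: leeD; apply: lee_wpmul2l.
  - by rewrite lee_fin.
  - by apply: (john_nirenberg a_bmo M_gt0 a_le) => //; exact: ltW.
  - by rewrite lee_fin; apply: mulr_ge0 => //; exact: powR_ge0.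
  - by rewrite lee_fin; exact: vol_le.
rewrite -!EFinM -EFinD lee_fin le_eqVlt; apply/orP; left; apply/eqP; ring.
Qed.

(** The three terms of [pointwise] are integrated separately; the power [r ^+ n.+2] comes
    from [s 0 `^ (Qp p)] in the near part and from the volume in the far part. *)
Lemma local_estimate : (\int[mu]_(y in E) (`|S f y| `^ p)%:E <=
  (local_const * (M * N * phi x0 r) `^ p * r ^+ n.+2)%:E)%E.
Proof.
have mE := measurable_ellipsoid x0 r.
have mS1 : measurable_fun setT (S f1) by have [[]] := S_Lp Lp_f1.
have mp (w : V -> R) : measurable_fun setT w -> measurable_fun E (fun y => `|w y| `^ p).
  exact: measurable_norm_powR.
pose L := C2 * M * (s 0%N `^ Qp p * H).
pose B := K `^ p * (2 `^ p * (jn_const n p + 2 ^+ n.+1)) * M `^ p * r ^+ n.+2.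
have bound e : 0 < e -> (\int[mu]_(y in E) (`|S f y| `^ p)%:E <=
    (4 `^ p * (L `^ p + B) + 4 `^ p * e)%:E)%E.
  move=> e0; have [w [mw we hw]] := pointwise e0.
  pose F y := `|S f1 y| `^ p + (G y `^ p + `|w y| `^ p).
  have mGp : measurable_fun E (fun y => G y `^ p).
    by apply: measurable_funTS; apply: (measurableT_comp (measurable_powR p)).
  have mF : measurable_fun E F.
    apply: measurable_funD; first exact: mp.
    by apply: measurable_funD => //; exact: mp.
  have F0 y : 0 <= F y by rewrite !addr_ge0 ?powR_ge0.
  apply: (@le_trans _ _ (\int[mu]_(y in E) (4 `^ p * F y)%:E)%E).
    apply: ae_ge0_le_integral => //.
    - by apply/measurable_EFinP; apply: mp; exact: measurable_S.
    - by move=> y _; rewrite lee_fin mulr_ge0 ?powR_ge0.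
    - by apply/measurable_EFinP; exact: measurable_funM.
    apply: filterS hw => y hy Ey; rewrite lee_fin.
    apply: (@le_trans _ _ ((`|S f1 y| + (G y + `|w y|)) `^ p)).
      by apply: powR_le => //; rewrite addrA; exact: hy.
    apply: (le_trans (powRD_le p_ge0 (normr_ge0 _) (addr_ge0 (G_ge0 _) (normr_ge0 _)))).
    have -> : 4 `^ p = 2 `^ p * 2 `^ p :> R.
      by rewrite -powRM//; congr (_ `^ _); ring.
    rewrite -mulrA; apply: ler_wpM2l; first exact: powR_ge0.
    rewrite /F [leRHS]mulrDr; apply: lerD; last exact: powRD_le.
    rewrite ler_peMl ?powR_ge0//.
    by rewrite -[leLHS](powRr0 (2 : R)) ler_powR// ler1n.
  rewrite integralZ_EFin ?powR_ge0// -mulrDr EFinM; apply: lee_wpmul2l.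
    by rewrite lee_fin powR_ge0.
  rewrite -addrA !EFinD; apply: le_trans (_ : (_ <=
    \int[mu]_(y in E) (`|S f1 y| `^ p)%:E + \int[mu]_(y in E) (G y `^ p + `|w y| `^ p)%:E)%E) _.
    apply: le_integralD => //.
    - exact: mp.
    - by apply: measurable_funD => //; exact: mp.
    - by move=> y _; apply: addr_ge0; exact: powR_ge0.
  apply: leeD.
    apply: le_trans near_part.
    by apply: le_nonneg_integral_set => // y; rewrite lee_fin powR_ge0.
  apply: le_trans (leeD integral_G we).
  apply: le_integralD => //.
  - exact: mp.
  - by move=> y _; exact: powR_ge0.
  - by move=> y _; apply: addr_ge0; exact: powR_ge0.
have -> : local_const * (M * N * phi x0 r) `^ p * r ^+ n.+2 = 4 `^ p * (L `^ p + B).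
  have u0 : 0 <= M * N * phi x0 r.
    by apply: mulr_ge0; [apply: mulr_ge0; exact: ltW|exact/ltW/phi_gt0].
  have g0 : 0 <= growth_const n p * C0 by apply: mulr_ge0; exact: ltW.
  have nc0 : 0 <= near_const.
    by apply: mulr_ge0 => //; apply: mulr_ge0; [exact: ltW|exact: powR_ge0].
  have fc0 : 0 <= far_part_const.
    by apply: mulr_ge0 => //; apply: mulr_ge0; [exact: ltW|exact: far_const_ge0].
  have LE : L `^ p = near_const `^ p * (M * N * phi x0 r) `^ p * r ^+ n.+2.
    have -> : L = near_const * (M * N * phi x0 r) * r `^ Qp p.
      rewrite /L /near_const /H /dyadic_radius (powRM _ (exprn_ge0 _ _) (ltW r_gt0))//.
      by rewrite (_ : 2 ^+ 2 = 4); ring.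
    rewrite (powRM p (mulr_ge0 nc0 u0) (powR_ge0 _ _)) (powRM p nc0 u0).
    by rewrite -[r `^ _ `^ p]powRrM divfK// powR_mulrn// ltW.
  have KE : K `^ p * M `^ p = far_part_const `^ p * (M * N * phi x0 r) `^ p.
    rewrite -(powRM p K_ge0 (ltW M_gt0)) -(powRM p fc0 u0); congr (_ `^ _).
    by rewrite /K /far_part_const /H; ring.
  rewrite /local_const LE /B.
  rewrite [K `^ p * _ * M `^ p](_ : _ = K `^ p * M `^ p * (2 `^ p * (jn_const n p + 2 ^+ n.+1))); last by ring.
  rewrite KE; ring.
apply/lee_addgt0Pr => e e0.
have p4 : 0 < 4 `^ p :> R by rewrite powR_gt0.
have := bound (e / 4 `^ p) (divr_gt0 e0 p4).
by rewrite [4 `^ p * (e / _)]mulrC divfK ?gt_eqF// EFinD.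
Qed.

End local_estimate.

(** * The Morrey norm *)

Section norms.
Context {R : realType} (n : nat).
Local Notation V := 'rV[R]_n.+1.
Local Notation mu := (@lebesgue_rV R n.+1).

Lemma morrey_norm_ge0 p (phi : V -> R -> R) (f : V -> R) :
  (forall x r, 0 < r -> 0 < phi x r) -> (0 <= morrey_norm p phi f)%E.
Proof.
move=> phi_gt0; apply: le_ereal_sup_tmp; eexists.
  by exists (0, 1) => //=; exact: ltr01.
by rewrite mule_ge0 ?poweR_ge0// lee_fin invr_ge0 ltW// phi_gt0.
Qed.

Lemma local_const_ge0 p (C0 C1 C2 : R) : 0 <= local_const n p C0 C1 C2.
Proof.
apply: mulr_ge0; first exact: powR_ge0.
apply: addr_ge0; first exact: powR_ge0.
apply: mulr_ge0; first exact: powR_ge0.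
apply: mulr_ge0; first exact: powR_ge0.
by apply: addr_ge0; [exact: jn_const_ge0|exact: exprn_ge0].
Qed.

Lemma morrey_norm_le p (phi : V -> R -> R) (g : V -> R) K L : 0 < p -> 0 <= K -> 0 <= L ->
  (forall x r, 0 < r -> 0 < phi x r) ->
  (forall x r, 0 < r -> (\int[mu]_(y in ellipsoid x r) (`|g y| `^ p)%:E <=
    (K * (L * phi x r) `^ p * r ^+ n.+2)%:E)%E) ->
  (morrey_norm p phi g <= (K `^ p^-1 * L)%:E)%E.
Proof.
move=> p0 K0 L0 phi_gt0 h; apply: ge_ereal_sup => _ [[x r] /= r0 <-].
have f0 := phi_gt0 x r r0.
have rQ : 0 < r ^+ n.+2 by rewrite exprn_gt0.
have L1 : 0 <= L * phi x r by rewrite mulr_ge0// ltW.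
have i0 : (0 <= \int[mu]_(y in ellipsoid x r) (`|g y| `^ p)%:E)%E.
  by apply: integral_ge0 => y _; rewrite lee_fin powR_ge0.
have le1 : ((r ^- n.+2)%:E * \int[mu]_(y in ellipsoid x r) (`|g y| `^ p)%:E <=
    (K * (L * phi x r) `^ p)%:E)%E.
  by rewrite lee_pdivrMl// (le_trans (h x r r0))// -EFinM lee_fin mulrC.
have le2 : (((r ^- n.+2)%:E * \int[mu]_(y in ellipsoid x r) (`|g y| `^ p)%:E) `^ p^-1 <=
    (K `^ p^-1 * (L * phi x r))%:E)%E.
  have -> : K `^ p^-1 * (L * phi x r) = (K * (L * phi x r) `^ p) `^ p^-1.
    by rewrite powRM ?powR_ge0// powRK// gt_eqF.
  rewrite -poweR_EFin; apply: gt0_ler_poweR => //; rewrite ?invr_ge0 ?(ltW p0)//.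
    by rewrite in_itv/= leey andbT mule_ge0// lee_fin invr_ge0 ltW.
  by rewrite in_itv/= leey andbT lee_fin mulr_ge0 ?powR_ge0.
rewrite lee_pdivrMl// (le_trans le2)// -EFinM lee_fin.
by rewrite le_eqVlt; apply/orP; left; apply/eqP; ring.
Qed.

End norms.

Theorem theorem3p7 (R : realType) (n : nat) (p : R) (hp : 1 < p)
    (phi : 'rV[R]_n.+1 -> R -> R)
    (phi_meas : measurable_fun [set xr : 'rV[R]_n.+1 * R | 0 < xr.2]
                  (fun xr => phi xr.1 xr.2))
    (phi_gt0 : forall x r, 0 < r -> 0 < phi x r)
    (C0 : R) (hC0 : 0 < C0)
    (phi_cond : forall x r, 0 < r ->
      (\int[@lebesgue_measure R]_(s in `]r, +oo[)
         ((1 + ln (s / r))%:E *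
          (essinf_tail p phi x s * ((s `^ (n.+2%:R / p + 1))^-1)%:E))
       <= (C0 * phi x r)%:E)%E)
    (T : ('rV[R]_n.+1 -> R) -> ('rV[R]_n.+1 -> R) -> ('rV[R]_n.+1 -> R))
    (T_sublinear : forall a, BMO a -> forall f g, Lp p f -> Lp p g ->
      {ae (lebesgue_rV n.+1), forall x,
        `|T a (f \+ g) x| <= `|T a f x| + `|T a g x|})
    (C1 : R) (hC1 : 0 < C1)
    (T_pointwise : forall a, BMO a ->
      forall f, (@lebesgue_rV R n.+1).-integrable setT (EFin \o f) -> compact (supp f) ->
      forall x, ~ supp f x ->
      (`|T a f x|%:E <=
       C1%:E * \int[(lebesgue_rV n.+1)]_y
         (`|a x - a y| * (`|f y| / rho (x - y) ^+ n.+2))%:E)%E)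
    (C2 : R) (hC2 : 0 < C2)
    (T_Lp : forall a, BMO a -> forall f, Lp p f ->
      Lp p (T a f) /\
      ('N[(lebesgue_rV n.+1)]_(p%:E)[EFin \o T a f] <=
       C2%:E * bmo_norm a * 'N[(lebesgue_rV n.+1)]_(p%:E)[EFin \o f])%E) :
  exists C : R, 0 < C /\
    forall a, BMO a -> forall f, morrey p phi f -> determined_on_Lp p (T a) f ->
      morrey p phi (T a f) /\
      (morrey_norm p phi (T a f) <= C%:E * bmo_norm a * morrey_norm p phi f)%E.
Proof.
have p0 : 0 < p by exact: lt_trans hp.
pose K := local_const n p C0 C1 C2.
have K0 : 0 <= K by exact: local_const_ge0.
pose C := K `^ p^-1 + 1.
have C_gt0 : 0 < C by rewrite ltr_wpDl// powR_ge0.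
exists C; split; first exact: C_gt0.
move=> a a_bmo f [lf f_fin] det.
have mTf : measurable_fun setT (T a f) by exact: (measurable_S (T_Lp a a_bmo) det).
have [b bE] : exists b, bmo_norm a = b%:E.
  by exists (fine (bmo_norm a)); rewrite fineK// ge0_fin_numE ?bmo_norm_ge0//; exact: a_bmo.2.
have [m mE] : exists m, morrey_norm p phi f = m%:E.
  by exists (fine (morrey_norm p phi f)); rewrite fineK// ge0_fin_numE ?morrey_norm_ge0.
have b0 : 0 <= b by rewrite -lee_fin -bE bmo_norm_ge0.
have m0 : 0 <= m by rewrite -lee_fin -mE morrey_norm_ge0.
(* [t] makes the bounds on the norms positive, also where a norm vanishes *)
have local t : 0 < t -> forall x r, 0 < r ->
    (\int[lebesgue_rV n.+1]_(y in ellipsoid x r) (`|T a f y| `^ p)%:E <=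
     (K * ((b + t) * (m + t) * phi x r) `^ p * r ^+ n.+2)%:E)%E.
  move=> t0 x r r0.
  have bt : 0 < b + t by rewrite ltr_wpDl.
  have mt : 0 < m + t by rewrite ltr_wpDl.
  have a_le : (bmo_norm a <= (b + t)%:E)%E by rewrite bE lee_fin lerDl ltW.
  have f_le : (morrey_norm p phi f <= (m + t)%:E)%E by rewrite mE lee_fin lerDl ltW.
  exact: (local_estimate hp phi_gt0 hC0 phi_cond a_bmo bt a_le (T_sublinear a a_bmo)
    hC1 (T_pointwise a a_bmo) hC2 (T_Lp a a_bmo) lf mt f_le x r0 det).
have bound t : 0 < t -> (morrey_norm p phi (T a f) <= (C * ((b + t) * (m + t)))%:E)%E.
  move=> t0; have L0 : 0 <= (b + t) * (m + t) by rewrite mulr_ge0// addr_ge0// ltW.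
  apply: (le_trans (morrey_norm_le p0 K0 L0 phi_gt0 (local t t0))).
  by rewrite lee_fin ler_wpM2r// lerDl.
split.
  split; last by apply: le_lt_trans (bound 1 ltr01) _; exact: ltry.
  split => // A cA; have [r r0 Ar] := compact_sub_ellipsoid 0 cA.
  have Afin := le_lt_trans (local 1 ltr01 0 r r0) (ltry _).
  by apply: le_lt_trans Afin; apply: le_nonneg_integral_set => // y; rewrite lee_fin powR_ge0.
(* [t] tends to zero *)
rewrite bE mE -!EFinM; apply/lee_addgt0Pr => e e0.
pose D := C * (b + m + 1).
have D0 : 0 < D by rewrite mulr_gt0// ltr_wpDl// addr_ge0.
pose t := Num.min 1 (e / D).
have t0 : 0 < t by rewrite lt_min ltr01 divr_gt0.
have t1 : t <= 1 by rewrite ge_min lexx.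
have tD : t * D <= e by rewrite -ler_pdivlMr// ge_min lexx orbT.
apply: (le_trans (bound t t0)); rewrite -EFinD lee_fin.
have : C * (t * (b + m + t)) <= t * D.
  rewrite /D mulrCA ler_pM2l// ler_pM2l//; lra.
have -> : C * ((b + t) * (m + t)) = C * b * m + C * (t * (b + m + t)) by ring.
lra.
Qed.
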